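(* For an integer $n\geq 1$ and a real $\delta>0$, let $$c_{n,\delta}:=\inf\ \mathbb{P}\left(S<\mathbb{E}S+\delta\right),\qquad S=\sum_{i=1}^n X_i,$$ where the infimum is over all independent nonnegative real random variables $X_1,\ldots,X_n$ satisfying $\mathbb{E}X_i\leq 1$ for $1\leq i\leq n$. Then for every $n\geq 1$ and every $\delta>0$, $$c_{n,\delta}=\min\left\{\frac{\delta}{1+\delta},\ \left(1-\frac{1}{n+\delta}\right)^n\right\},$$ and the bound is sharp and is attained for every fixed pair $(n,\delta)$, i.e. there exist independent nonnegative random variables $X_1,\ldots,X_n$ with $\mathbb{E}X_i\leq 1$ for which $\mathbb{P}(S<\mathbb{E}S+\delta)$ equals the right-hand side. Moreover, for every $\delta>0$, $$\inf_{n\geq 1}c_{n,\delta}=\min\left\{\frac{\delta}{1+\delta},\ e^{-1}\right\}.$$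
   Context: The infimum defining $c_{n,\delta}$ ranges over all choices of the laws of $X_1,\ldots,X_n$, i.e. over all product measures $\nu_1\otimes\cdots\otimes\nu_n$ where each $\nu_i$ is a Borel probability measure on $[0,\infty)$ with mean at most $1$. *)

(* Defs.v *)
From HB Require Import structures.
From mathcomp Require Import all_boot all_order all_algebra.
From mathcomp Require Import all_classical all_reals all_analysis.

Set Implicit Arguments.
Unset Strict Implicit.
Unset Printing Implicit Defensive.

Import Order.TTheory GRing.Theory Num.Theory.

Local Open Scope classical_set_scope.
Local Open Scope ring_scope.

Definition independent_RVs (R : realType) (d : measure_display)
    (T : measurableType d) (P : probability T R) (I : finType)
    (X : I -> {RV P >-> R}) : Prop :=
  forall (J : {set I}) (B : I -> set R),
    (forall i, measurable (B i)) ->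
    P (\bigcap_(i in [set` J]) (X i @^-1` B i)) =
    (\prod_(i in J) P (X i @^-1` B i))%E.

Definition RV_sum (R : realType) (d : measure_display) (T : measurableType d)
    (P : probability T R) (n : nat) (X : 'I_n -> {RV P >-> R}) : T -> R :=
  fun w => \sum_(i < n) X i w.

Definition admissible (R : realType) (d : measure_display)
    (T : measurableType d) (P : probability T R) (n : nat)
    (X : 'I_n -> {RV P >-> R}) : Prop :=
  [/\ independent_RVs X,
      forall i w, 0 <= X i w
    & forall i, ('E_P[X i] <= 1)%E].

Definition small_deviation_prob (R : realType) (d : measure_display)
    (T : measurableType d) (P : probability T R) (n : nat)
    (X : 'I_n -> {RV P >-> R}) (delta : R) : \bar R :=
  P [set w | ((RV_sum X w)%:E < 'E_P[RV_sum X] + delta%:E)%E].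

(* The sample space is not fixed: the infimum runs over all of them, hence over
   all choices of the laws of the variables. *)
Definition c_inf (R : realType) (n : nat) (delta : R) : \bar R :=
  ereal_inf [set p : \bar R |
    exists (d : measure_display) (T : measurableType d) (P : probability T R)
      (X : 'I_n -> {RV P >-> R}),
      admissible X /\ p = small_deviation_prob X delta].

(* Main.v *)
Require Import Defs.
From HB Require Import structures.
From mathcomp Require Import all_boot all_order all_algebra.
From mathcomp Require Import all_classical all_reals all_analysis.
From mathcomp Require Import measurable_realfun zify ring lra.

Set Implicit Arguments.
Unset Strict Implicit.
Unset Printing Implicit Defensive.

Import Order.TTheory GRing.Theory Num.Theory.
Import numFieldNormedType.Exports.

Local Open Scope classical_set_scope.
Local Open Scope ring_scope.

(* Let F = P(S < u) and A = E(u - S)^+.  The heart of the proof is an inequality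
   between F, A and E S - u which is preserved when an independent variable is
   added to S.  Write r = A / F and ell r = - ln (1 - 1 / r), which is the decay
   rate of (1 - 1 / r) ^ t.  The inequality is
     - ln F * rate r <= E S - u + r,
   where rate = 1 / ell beyond the point tau with ell tau = 1, and is continued
   on the left of tau by the tangent of z |-> 1 / ell (1 / z), so that
   z |-> rate (1 / z) is convex; a second, linear, inequality covers r < tau.
   For two-point variables with values 0 and b the induction step is either a
   convex combination of the inequalities at u and u - b or an instance of
   Bernoulli's inequality.  At u = E S + delta one has A >= delta and
   r <= n + delta, and the bound follows because r |-> (r - delta) * ell r is
   quasiconvex, its values at 1 + delta and n + delta being minus the logarithms
   of the two terms of the minimum.

   General laws are discretized on a fine grid, each value being rounded up, and
   finite laws are replaced one at a time by two-point laws with the same mean: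
   P(S < u) is affine in each law.  The two terms of the minimum are attained by
   a single variable (1 + delta) * Bernoulli (the others being 1), and by n
   variables (n + delta) * Bernoulli. *)

(** * Real analysis *)

Section Analysis.
Variable R : realType.
Implicit Types x y z a b c d k t u v w rho delta : R.

Lemma nondecreasing_derive (f df : R -> R) a b : a <= b ->
  (forall x, a <= x <= b -> is_derive x 1 f (df x)) ->
  (forall x, a <= x <= b -> 0 <= df x) -> f a <= f b.
Proof.
move=> ab fd dfp.
have [||c] := @MVT_segment _ f df a b ab.
- by move=> x; rewrite in_itv/= => /andP[ax xb]; apply: fd; rewrite !ltW.
- apply: derivable_within_continuous => x; rewrite in_itv/= => xab.
  by case: (fd x xab).
- rewrite in_itv/= => cab E; rewrite -subr_ge0 E mulr_ge0 ?dfp// subr_ge0//.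
Qed.

(** The left side is the Pade approximant of [ln] at 1. With the denominator cleared both sides
    vanish at 1, and the difference has a nonnegative derivative because ln (1 / y) <= 1 / y - 1. *)
Lemma ln_ge_pade y : 1 <= y -> 2 * (y - 1) / (y + 1) <= ln y.
Proof.
move=> y1; rewrite ler_pdivrMr; last by lra.
rewrite -subr_ge0.
pose f z : R := ln z * (z + 1) - 2 * (z - 1).
have -> : 0 = f 1 by rewrite /f ln1; ring.
rewrite -/(f y).
apply: (nondecreasing_derive y1 (df := fun y => ln y + y^-1 - 1)) => x /andP[x1 _].
- have x0 : 0 < x by lra.
  have := is_derive1_ln x0 => ?.
  apply: is_derive_eq.
  by rewrite /GRing.scale/=; field; rewrite gt_eqF.
- have x0 : 0 < x by lra.
  have := @le_ln1Dx R (x^-1 - 1).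
  rewrite (addrC 1) subrK lnV// => /(_ _) H.
  have : - 1 < x^-1 - 1 by rewrite ltrBrDl subrr invr_gt0.
  by move=> /H; lra.
Qed.

Lemma ln_le_geomean y : 1 <= y -> 2 * ln y <= y - y^-1.
Proof.
move=> y1; have y0 : 0 < y by lra.
have -> : y - y^-1 = (y ^+ 2 - 1) / y by field; rewrite gt_eqF.
rewrite ler_pdivlMr// -subr_ge0.
pose f z : R := z * z - 1 - 2 * ln z * z.
have -> : 0 = f 1 by rewrite /f ln1; ring.
rewrite expr2 -/(f y).
apply: (nondecreasing_derive y1 (df := fun y => 2 * (y - 1 - ln y))) => x /andP[x1 _].
- have x0 : 0 < x by lra.
  have := is_derive1_ln x0 => ?.
  apply: is_derive_eq.
  by rewrite /GRing.scale/=; field; rewrite gt_eqF.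
- have := @le_ln1Dx R (x - 1).
  rewrite (addrC 1) subrK => /(_ _) H.
  have : - 1 < x - 1 by lra.
  by move=> /H; lra.
Qed.

(** [ln_le_geomean] at the square root of y, squared. At y = x / (x - 1) the right side is 1 / (x (x
    - 1)), which is how it enters [ell_sqr_le]. *)
Lemma ln_sqr_le y : 1 <= y -> ln y ^+ 2 <= (y - 1) ^+ 2 / y.
Proof.
move=> y1; have y0 : 0 < y by lra.
have s1 : 1 <= Num.sqrt y by rewrite -[leLHS]sqrtr1; apply: ler_wsqrtr.
have E : Num.sqrt y ^+ 2 = y by rewrite sqr_sqrtr// ltW.
move: (Num.sqrt y) s1 E => s s1 <-.
have s0 : 0 < s by lra.
have L : ln (s ^+ 2) = 2 * ln s by rewrite lnXn// mulr_natl.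
have -> : (s ^+ 2 - 1) ^+ 2 / s ^+ 2 = (s - s^-1) ^+ 2 by field; rewrite gt_eqF.
rewrite L ler_sqr ?nnegrE ?ln_le_geomean//.
- by rewrite mulr_ge0// ln_ge0.
- by rewrite subr_ge0 (le_trans _ s1)// invf_le1.
Qed.

End Analysis.

(** * The function [rate]: supporting lines, convexity, slope *)

Section Rate.
Variable R : realType.
Implicit Types x y z a b c d g k p s t : R.

Notation e := (expR 1 : R).

(** The constant has to exceed (3 + sqrt 5) / 2 = 2.618..., the larger root of t ^ 2 - 3 t + 1. The
    bound (1 + 1 / 16) ^ 16 is precise enough; it is evaluated by four squarings, each rounded
    down. *)
Lemma expR1_gt2 : 262 / 100 <= e.
Proof.
have h1 : 17 / 16 <= expR (16^-1 : R) by apply: le_trans (expR_ge1Dx _); lra.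
have -> : 1 = 16%:R * 16^-1 :> R by rewrite mulfV// pnatr_eq0.
rewrite expRM_natl; apply: (@le_trans _ _ ((17 / 16) ^+ 16)); last first.
  by rewrite lerXn2r ?nnegrE ?expR_ge0// divr_ge0.
have h2 (p : R) (r q : R) n : 0 <= q -> q <= p ^+ n -> r <= q * q -> r <= p ^+ (n + n).
  by move=> q0 qp rq; rewrite exprD (le_trans rq)// ler_pM.
apply: (@h2 _ _ (1623/1000) 8); [lra| |lra].
apply: (@h2 _ _ (1274/1000) 4); [lra| |lra].
apply: (@h2 _ _ (11289/10000) 2); [lra| |lra].
by rewrite expr2; lra.
Qed.

Definition tau : R := e / (e - 1).

Lemma tau_gt1 : 1 < tau.
Proof. by rewrite /tau ltr_pdivlMr; have := expR1_gt2; lra. Qed.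

Lemma tau_le2 : tau <= 2.
Proof. by rewrite /tau ler_pdivrMr; have := expR1_gt2; lra. Qed.

Lemma tau_gt0 : 0 < tau. Proof. by have := tau_gt1; lra. Qed.

Lemma tauV : tau^-1 = 1 - e^-1.
Proof.
by rewrite /tau invf_div mulrBl mul1r divff// gt_eqF.
Qed.

Lemma tau_mulV : tau * e^-1 = tau - 1.
Proof.
have -> : e^-1 = 1 - tau^-1 by rewrite tauV; ring.
by rewrite mulrBr mulr1 mulfV// gt_eqF// tau_gt0.
Qed.

(** Both [tau_sqr_le] and [tau_golden] reduce to this after substituting [tau] = e / (e - 1). *)
Lemma expR1_quadratic : 0 <= e * e - 3 * e + 1.
Proof.
have e2 := expR1_gt2.
have : 0 <= (e - 262 / 100) * (e - 38 / 100) by rewrite mulr_ge0; lra.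
lra.
Qed.

Lemma tau_sqr_le : tau ^+ 2 <= e.
Proof.
have e2 := expR1_gt2; rewrite /tau expr_div_n ler_pdivrMr; last by apply: exprn_gt0; lra.
have := mulr_ge0 (expR_ge0 1) expR1_quadratic.
by rewrite !expr2; lra.
Qed.

Lemma tau_golden : tau ^+ 2 <= tau + 1.
Proof.
have e2 := expR1_gt2.
rewrite /tau expr_div_n ler_pdivrMr; last by apply: exprn_gt0; lra.
have -> : (e / (e - 1) + 1) * (e - 1) ^+ 2 = (2 * e - 1) * (e - 1).
  by field; rewrite gt_eqF//; lra.
by have := expR1_quadratic; rewrite !expr2; lra.
Qed.

Definition ell x : R := - ln (1 - x^-1).

Lemma expR_ell x : 1 < x -> expR (- ell x) = 1 - x^-1.
Proof.
by move=> x1; rewrite /ell opprK lnK// posrE subr_gt0 invf_lt1// (lt_trans ltr01).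
Qed.

Lemma inv_lt1 x : 1 < x -> 0 < x^-1 < 1.
Proof. by move=> x1; rewrite invr_gt0 invf_lt1 ?x1 ?(lt_trans ltr01). Qed.

Lemma ell_gt0 x : 1 < x -> 0 < ell x.
Proof.
move=> x1; have h := inv_lt1 x1.
by rewrite -oppr_lt0 -expR_lt1 expR_ell//; lra.
Qed.

Lemma ell_le1 x : tau <= x -> ell x <= 1.
Proof.
move=> tx; have t1 := tau_gt1; have x1 : 1 < x by lra.
rewrite -lerN2 -ler_expR expR_ell// expRN.
have : x^-1 <= tau^-1 by rewrite lef_pV2 ?posrE//; lra.
by rewrite tauV; lra.
Qed.

Lemma ell_tau : ell tau = 1.
Proof.
by rewrite /ell tauV opprB addrC subrK -expRN expRK opprK.
Qed.

Definition rate x : R := if x <= tau then e * (1 - x^-1) else (ell x)^-1.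

Lemma rate_left x : x <= tau -> rate x = e * (1 - x^-1).
Proof. by rewrite /rate => ->. Qed.

Lemma rate_tau : rate tau = 1.
Proof.
rewrite rate_left// tauV opprB addrC subrK mulfV// gt_eqF.
Qed.

Lemma rate_right x : tau <= x -> rate x = (ell x)^-1.
Proof.
rewrite le_eqVlt => /orP[/eqP <-|tx]; first by rewrite rate_tau ell_tau invr1.
by rewrite /rate leNgt tx.
Qed.

(** With k = [ell x0] and d = [ell x] - [ell x0] this is the supporting line inequality at x0 for x
    beyond [tau]. It follows from expR (- d) <= 1 / (1 + d), as d / (1 + d) exceeds the left side by
    d ^ 2 (1 - k) / ((1 + d) (k + d)). *)
Lemma one_sub_expRN d k : 0 < k -> k <= 1 -> 0 < k + d ->
  k * d / (k + d) <= 1 - expR (- d).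
Proof.
move=> k0 k1 kd; rewrite expRN ler_pdivrMr//.
have hd : 0 < 1 + d by lra.
have h : (expR d)^-1 <= (1 + d)^-1.
  by rewrite lef_pV2 ?posrE ?expR_gt0 ?expR_ge1Dx.
have E : k * d = (1 - (1 + d)^-1) * (k + d) - d ^+ 2 * (1 - k) / (1 + d).
  by field; rewrite gt_eqF//; lra.
have : 0 <= d ^+ 2 * (1 - k) / (1 + d).
  apply: divr_ge0; last exact: ltW.
  by rewrite mulr_ge0 ?sqr_ge0// subr_ge0.
have : (1 - (1 + d)^-1) * (k + d) <= (1 - (expR d)^-1) * (k + d).
  by rewrite ler_pM2r//; lra.
rewrite E; lra.
Qed.


Lemma one_ge_mul_expR k : k * expR (1 - k) <= 1.
Proof.
have := expR_ge1Dx (k - 1); rewrite addrC subrK => h.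
have := ler_wpM2r (expR_ge0 (1 - k)) h.
by rewrite -expRD -(opprB 1 k) addNr expR0.
Qed.

(** For x > [tau] and k = [ell x] the line has the value expR (1 - k), which is at most 1 / k. *)
Lemma rate_ge_line x : 0 < x -> e * (1 - x^-1) <= rate x.
Proof.
move=> x0; have [xt|tx] := leP x tau; first by rewrite rate_left.
have x1 : 1 < x by have := tau_gt1; lra.
rewrite rate_right ?(ltW tx)// -expR_ell// -expRD.
by rewrite -div1r ler_pdivlMr ?ell_gt0// mulrC one_ge_mul_expR.
Qed.

(* In the variable z = 1 / x the graph of rate lies above its tangents, which
   are nonincreasing: rate is monotone and z |-> rate (1 / z) is convex. *)
Lemma rate_support x0 : 0 < x0 ->
  exists a b, [/\ 0 <= b, a - b / x0 = rate x0
    & forall x, 0 < x -> a - b / x <= rate x].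
Proof.
move=> x00; have [xt|tx0] := leP x0 tau.
  exists e, e; split; first exact: expR_ge0.
    by rewrite rate_left//; ring.
  by move=> x /rate_ge_line; rewrite mulrBr mulr1.
have t1 := tau_gt1.
have x01 : 1 < x0 by lra.
have k0 := ell_gt0 x01; have k1 := ell_le1 (ltW tx0).
have E0 := expR_ell x01.
have := expR_gt0 (- ell x0).
rewrite rate_right ?ltW//; move: (ell x0) k0 k1 E0 => k k0 k1 E0 Ep0.
have z0 : x0^-1 = 1 - expR (- k) by rewrite E0; ring.
rewrite z0; set w0 := expR (- k) in Ep0 *.
(* In z = 1 / x the function is - 1 / ln (1 - z); at z = 1 - w0, where ln w0 = - k, its slope is - 1
   / (w0 k ^ 2). *)
exists (k^-1 + (1 - w0) / (w0 * k ^+ 2)), (w0 * k ^+ 2)^-1; split.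
- by rewrite invr_ge0 mulr_ge0 ?sqr_ge0// ltW.
- by field; rewrite !gt_eqF.
move=> x xp.
have -> : k^-1 + (1 - w0) / (w0 * k ^+ 2) - (w0 * k ^+ 2)^-1 / x =
    k^-1 - (1 - (1 - x^-1) / w0) / k ^+ 2.
  by field; rewrite !gt_eqF.
(* Left of [tau] the difference is affine in w = 1 - 1 / x <= 1 / e with nonpositive slope, so w = 1
   / e is the worst case. *)
have [xt|tx] := leP x tau.
  rewrite rate_left//.
  have wle : 1 - x^-1 <= e^-1.
    have : tau^-1 <= x^-1 by rewrite lef_pV2 ?posrE ?tau_gt0.
    by rewrite tauV; lra.
  move: (1 - x^-1) wle => w wle.
  rewrite -subr_ge0.
  have kk : 0 < k ^+ 2 by rewrite exprn_gt0.
  rewrite -(pmulr_lge0 _ kk).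
  have -> : (e * w - (k^-1 - (1 - w / w0) / k ^+ 2)) * k ^+ 2 =
     w * (e * k ^+ 2 - w0^-1) - (k - 1).
    by field; rewrite !gt_eqF.
  rewrite /w0 -expRN opprK.
  have Ek : expR k = e * expR (k - 1) by rewrite -expRD addrCA subrr addr0.
  rewrite Ek -mulrBr.
  have ep : 0 < e by exact: expR_gt0.
  have h1 := expR_ge1Dx (k - 1).
  have h2 : k ^+ 2 - expR (k - 1) <= 0.
    have : 0 <= k * (1 - k) by rewrite mulr_ge0; lra.
    by rewrite expr2; lra.
  have h3 : e^-1 * (e * (k ^+ 2 - expR (k - 1))) <= w * (e * (k ^+ 2 - expR (k - 1))).
    by rewrite ler_wnM2r// pmulr_rle0.
  rewrite mulKf ?gt_eqF// in h3.
  have h4 := @one_sub_expRN (1 - k) k k0 k1.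
  have kE : k + (1 - k) = 1 by ring.
  rewrite kE divr1 in h4.
  have h5 : expR (k - 1) <= k ^+ 2 - k + 1.
    have -> : k - 1 = - (1 - k) by ring.
    have := h4 ltr01; rewrite expr2; lra.
  lra.
rewrite rate_right ?(ltW tx)//.
have x1 : 1 < x by lra.
have m0 := ell_gt0 x1.
rewrite -expR_ell//; move: (ell x) m0 => m m0.
rewrite /w0 -expRN opprK -expRD.
have -> : - m + k = - (m - k) by ring.
have := @one_sub_expRN (m - k) k k0 k1.
rewrite addrC subrK => /(_ m0) h.
rewrite -subr_ge0; have kk : 0 < k ^+ 2 by rewrite exprn_gt0.
rewrite -(pmulr_lge0 _ kk).
have -> : (m^-1 - (k^-1 - (1 - expR (- (m - k))) / k ^+ 2)) * k ^+ 2 =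
  (1 - expR (- (m - k))) - k * (m - k) / m.
  by field; rewrite !gt_eqF.
lra.
Qed.

Lemma rate_le x y : 0 < x -> x <= y -> rate x <= rate y.
Proof.
move=> x0 xy; have [a [b [b0 <- /(_ y)]]] := rate_support x0.
have y0 : 0 < y by lra.
move=> /(_ y0); apply: le_trans.
by rewrite lerD2l lerN2 ler_wpM2l// lef_pV2.
Qed.

(** The supporting line at z is averaged over x and y. Since it is nonincreasing in the reciprocal,
    an inequality between reciprocals is enough. *)
Lemma rate_convex p x y z : 0 <= p <= 1 -> 0 < x -> 0 < y -> 0 < z ->
  (1 - p) / x + p / y <= z^-1 -> rate z <= (1 - p) * rate x + p * rate y.
Proof.
move=> /andP[p0 p1] x0 y0 z0 h; have [a [b [b0 <- H]]] := rate_support z0.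
have := ler_wpM2l p0 (H y y0).
have p2 : 0 <= 1 - p by lra.
have := ler_wpM2l p2 (H x x0).
have := ler_wpM2l b0 h.
lra.
Qed.

Lemma rate_le0 x : 0 < x <= 1 -> rate x <= 0.
Proof.
move=> /andP[x0 x1]; rewrite rate_left; last by have := tau_gt1; lra.
by rewrite pmulr_rle0 ?expR_gt0// subr_le0 invf_ge1.
Qed.

Lemma rate_ge0 x : 1 <= x -> 0 <= rate x.
Proof.
move=> x1; have x0 : 0 < x by lra.
by apply: le_trans (rate_ge_line x0); rewrite mulr_ge0 ?expR_ge0// subr_ge0 invf_le1.
Qed.

Lemma rate_mul_ell x : 1 < x -> rate x * ell x <= 1.
Proof.
move=> x1; have l0 := ell_gt0 x1; have [xt|tx] := leP x tau.
  by rewrite rate_left// -expR_ell// -expRD mulrC one_ge_mul_expR.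
by rewrite rate_right ?(ltW tx)// mulVf// gt_eqF.
Qed.

Lemma ellE x : 1 < x -> ell x = ln (x / (x - 1)).
Proof.
move=> x1; have h := inv_lt1 x1.
rewrite /ell -lnV ?posrE; last by lra.
by congr ln; field; apply/andP; split; apply/eqP; lra.
Qed.

Lemma ell_sqr_le x : 1 < x -> ell x ^+ 2 <= (x * (x - 1))^-1.
Proof.
move=> x1; have x10 : 0 < x - 1 by lra.
rewrite ellE//; apply: le_trans (ln_sqr_le _) _; first by rewrite ler_pdivlMr; lra.
rewrite le_eqVlt; apply/orP; left; apply/eqP.
by field; rewrite !gt_eqF//; lra.
Qed.

Lemma ell_ge x : 1 < x -> 2 / (2 * x - 1) <= ell x.
Proof.
move=> x1; have x10 : 0 < x - 1 by lra.
rewrite ellE//; apply: le_trans (ln_ge_pade _); last by rewrite ler_pdivlMr; lra.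
rewrite le_eqVlt; apply/orP; left; apply/eqP.
by field; rewrite !gt_eqF//; lra.
Qed.

Lemma ell_sub x : 1 < x -> ell x = ln x - ln (x - 1).
Proof. by move=> x1; rewrite ellE// ln_div// posrE; lra. Qed.

Lemma is_derive_ell x : 1 < x ->
  is_derive x 1 (fun y => ln y - ln (y - 1)) (- (x * (x - 1))^-1).
Proof.
move=> x1; have x0 : 0 < x by lra.
have x10 : 0 < x - 1 by lra.
have d1 := is_derive1_ln x0.
have d2 : is_derive x 1 (@ln R \o (fun y => y - 1)) (x - 1)^-1.
  rewrite -[(x - 1)^-1]mulr1; apply: is_derive1_comp; last first.
    by apply: is_derive_eq; rewrite subr0.
  exact: is_derive1_ln.
have -> : - (x * (x - 1))^-1 = x^-1 - (x - 1)^-1.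
  by field; rewrite !gt_eqF.
exact: is_deriveB.
Qed.

(** The derivative of 1 / [ell] at x is 1 / ([ell x] ^ 2 x (x - 1)), which is at least 1 by
    [ell_sqr_le]. *)
Lemma ellV_increment x y : 1 < x -> x <= y -> y - x <= (ell y)^-1 - (ell x)^-1.
Proof.
move=> x1 xy; suff : (ell x)^-1 - x <= (ell y)^-1 - y by lra.
rewrite !ell_sub//; last by lra.
pose f z : R := (ln z - ln (z - 1))^-1 - z.
rewrite -/(f x) -/(f y).
apply: (nondecreasing_derive xy
  (df := fun z => (ln z - ln (z - 1)) ^- 2 * (z * (z - 1))^-1 - 1)) => z /andP[xz _].
  have z1 : 1 < z by lra.
  have d := is_derive_ell z1.
  apply: is_deriveB.
  apply: is_derive_eq.
    by apply: is_deriveV; rewrite -ell_sub// gt_eqF// ell_gt0.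
  by rewrite /GRing.scale/=; ring.
have z1 : 1 < z by lra.
have l0 := ell_gt0 z1; have := ell_sqr_le z1.
rewrite -ell_sub// => h; rewrite subr_ge0 -invfM.
rewrite invf_ge1; last by rewrite mulr_gt0 ?exprn_gt0// mulr_gt0; lra.
have zz : 0 < z * (z - 1) by rewrite mulr_gt0; lra.
by rewrite -ler_pdivlMr// div1r.
Qed.

(** Left of [tau] the chord has slope e / (a b), and a b <= [tau] ^ 2 <= e; right of it
    [ellV_increment] applies. *)
Lemma rate_increment x y : 1 < x -> x <= y -> y - x <= rate y - rate x.
Proof.
have t1 := tau_gt1.
have left a b : 1 < a -> a <= b -> b <= tau -> b - a <= rate b - rate a.
  move=> a1 ab bt; rewrite !rate_left//; last exact: le_trans bt.
  have a0 : 0 < a by lra.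
  have b0 : 0 < b by lra.
  have -> : e * (1 - b^-1) - e * (1 - a^-1) = e * (b - a) / (a * b).
    by field; rewrite !gt_eqF.
  rewrite ler_pdivlMr ?mulr_gt0// mulrC ler_wpM2r ?subr_ge0//.
  apply: le_trans tau_sqr_le; rewrite expr2 ler_pM//; lra.
have right a b : tau <= a -> a <= b -> b - a <= rate b - rate a.
  by move=> ta ab; rewrite !rate_right//; [apply: ellV_increment|]; lra.
move=> x1 xy; have [yt|ty] := leP y tau; first exact: left.
have [xt|tx] := leP x tau; last by apply: right; lra.
have := left x tau x1 xt (lexx _).
have := right tau y (lexx _) (ltW ty).
lra.
Qed.

(** With x = A / F and k = - ln F this deduces the second inequality of [tail_bound] from the first.
    The bounds [rate x] >= 1 + x - [tau] and expR (1 - k) >= 2 - k leave (k - 1) (1 - [tau] + x (2 -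
    [tau])) >= 0, whose last factor is handled by [tau_golden] at x = [tau]. *)
Lemma rate_chord x k : tau <= x -> 1 <= k ->
  tau * x * (1 - expR (- k)) - (tau - 1) <= k * rate x.
Proof.
move=> tx k1; have t1 := tau_gt1; have t2 := tau_le2; have tg := tau_golden.
have h1 : 1 + x - tau <= rate x.
  by have := rate_increment t1 tx; rewrite rate_tau; lra.
have h2 : tau * (1 - expR (- k)) <= 1 + (tau - 1) * (k - 1).
  have h := expR_ge1Dx (1 - k).
  have -> : - k = (1 - k) - 1 by ring.
  rewrite expRB mulrBr mulr1 mulrCA tau_mulV.
  have h0 : 0 <= tau - 1 by lra.
  have := ler_wpM2l h0 h; lra.
have k0 : 0 <= k by lra.
have x0 : 0 <= x by lra.
have := ler_wpM2l k0 h1; have := ler_wpM2l x0 h2.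
have : 0 <= (k - 1) * (1 - tau + x * (2 - tau)).
  apply: mulr_ge0; first lra.
  have t20 : 0 <= 2 - tau by lra.
  have := ler_wpM2r t20 tx; rewrite expr2 in tg; lra.
lra.
Qed.

Lemma ln_weighted_le g p : 0 < g -> 0 <= p <= 1 ->
  p * ln g <= ln (1 - p + p * g).
Proof.
move=> g0 /andP[p0 p1]; have p1' : 0 <= 1 - p by lra.
set w := ln g; have -> : g = expR w by rewrite lnK.
have : expR (p * w) <= 1 - p + p * expR w.
  have h1 := expR_ge1Dx (- (p * w)); have h2 := expR_ge1Dx (w - p * w).
  have -> : expR w = expR (w - p * w) * expR (p * w).
    by rewrite -expRD; congr expR; ring.
  set E := expR (p * w).
  have E1 : expR (- (p * w)) * E = 1 by rewrite -expRD addNr expR0.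
  have E0 : 0 < E by exact: expR_gt0.
  have := ler_wpM2r (ltW E0) h1; rewrite E1 => h3.
  have := ler_wpM2l p0 (ler_wpM2r (ltW E0) h2).
  have := ler_wpM2l p1' h3.
  lra.
move=> h; rewrite -ler_expR lnK// posrE.
exact: lt_le_trans (expR_gt0 _) h.
Qed.

(** Bernoulli's inequality (1 - 1 / x) ^ t <= 1 - t / x for 0 <= t <= 1, in logarithmic form. *)
Lemma ln_bernoulli x t s : 1 < x -> 0 <= t <= 1 -> s * x <= t ->
  - ln (1 - s) <= t * ell x.
Proof.
move=> x1 t01 sx; have x0 : 0 < x by lra.
have hx := inv_lt1 x1.
have tx : t / x <= t by rewrite ler_piMr//; lra.
rewrite lerNl /ell -mulNr mulrNN.
apply: le_trans (ln_weighted_le _ t01) _; first by lra.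
have E : 1 - t + t * (1 - x^-1) = 1 - t / x by ring.
have h : t / x < 1.
  by case/andP: t01 => _ t1; rewrite ltr_pdivrMr// mul1r (le_lt_trans t1).
have tx2 : 1 - t / x <= 1 - s by rewrite lerD2l lerN2 ler_pdivlMr.
by rewrite E ler_ln// posrE; lra.
Qed.

End Rate.

(** * Quasiconvexity in the ratio, and comparison over the number of variables *)

Section Extremal.
Variable R : realType.
Implicit Types x y z a b c d k t u v w rho delta : R.

(** x - x (x - 1) [ell x] is the delta for which x is a critical point of z |-> (z - delta) [ell z].
    That it is nonincreasing amounts to [ell_ge]. *)
Lemma ell_threshold_anti x y : 1 < x -> x <= y ->
  y - y * (y - 1) * ell y <= x - x * (x - 1) * ell x.
Proof.
move=> x1 xy; rewrite !ell_sub//; last by lra.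
pose f z : R := z * (z - 1) * (ln z - ln (z - 1)) - z.
suff : f x <= f y by rewrite /f; lra.
apply: (nondecreasing_derive xy
  (df := fun z => (2 * z - 1) * (ln z - ln (z - 1)) - 2)) => z /andP[xz _].
  have z1 : 1 < z by lra.
  have d := is_derive_ell z1.
  apply: is_derive_eq; rewrite /GRing.scale/=.
  by field; rewrite !gt_eqF//; lra.
have z1 : 1 < z by lra.
have := ell_ge z1; rewrite ell_sub// ler_pdivrMr; lra.
Qed.

(** By [ell_threshold_anti] the derivative can only change sign from negative to positive. Comparing
    delta with the threshold at x tells which endpoint dominates. *)
Lemma ell_quasiconvex delta a b x : 1 < a -> a <= x -> x <= b ->
  (x - delta) * ell x <= Num.max ((a - delta) * ell a) ((b - delta) * ell b).
Proof.
move=> a1 ax xb; have x1 : 1 < x by lra.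
pose f z : R := (z - delta) * (ln z - ln (z - 1)).
pose df z : R := (ln z - ln (z - 1)) - (z - delta) * (z * (z - 1))^-1.
have fd z : 1 < z -> is_derive z 1 f (df z).
  move=> z1; have d := is_derive_ell z1.
  apply: is_derive_eq; rewrite /GRing.scale/= /df.
  by field; rewrite !gt_eqF//; lra.
have dfE z : 1 < z ->
    df z = (delta - (z - z * (z - 1) * ell z)) / (z * (z - 1)).
  move=> z1; rewrite /df ell_sub//.
  by field; rewrite !gt_eqF//; lra.
rewrite le_max !ell_sub//; last by lra.
rewrite -/(f x) -/(f a) -/(f b).
have [h|h] := leP (x - x * (x - 1) * ell x) delta; apply/orP; [right|left].
  apply: (nondecreasing_derive xb (df := df)) => z /andP[xz _].
    by apply: fd; lra.
  rewrite dfE; last by lra.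
  apply: divr_ge0; last by rewrite mulr_ge0; lra.
  have := ell_threshold_anti x1 xz; lra.
rewrite -lerN2.
apply: (nondecreasing_derive ax (df := fun z => - df z) (f := fun z => - f z))
  => z /andP[az zx].
  by apply: is_deriveN; apply: fd; lra.
have z1 : 1 < z by lra.
rewrite dfE// -mulNr.
apply: divr_ge0; last by rewrite mulr_ge0; lra.
have := ell_threshold_anti z1 zx; lra.
Qed.

(** This controls the second term of the minimum uniformly in n. Let p and q be [ell] at 1 + delta
    and m + delta; then m - 1 <= 1 / q - 1 / p by [ellV_increment], whence m q <= 1 if p <= 1 and m
    q <= p otherwise. *)
Lemma mul_ell_le_max m delta : 1 <= m -> 0 < delta ->
  m * ell (m + delta) <= Num.max (ell (1 + delta)) 1.
Proof.
move=> m1 d0.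
have d1 : 1 < 1 + delta by lra.
have md : 1 < m + delta by lra.
have := @ellV_increment R _ (m + delta) d1.
have l1 := ell_gt0 d1; have l2 := ell_gt0 md.
move: (ell (1 + delta)) (ell (m + delta)) l1 l2 => p q p0 q0.
move=> /(_ _) h.
have {h} : m - 1 <= q^-1 - p^-1 by have := h; lra.
rewrite le_max -[m * q <= p]ler_pdivlMr// -[m * q <= 1]ler_pdivlMr// div1r => h.
have [p1|p1] := leP p 1.
  have : 1 <= p^-1 by rewrite invf_ge1.
  by move=> h1; apply/orP; right; lra.
apply/orP; left.
have := ler_wpM2l (ltW p0) h.
rewrite !mulrBr mulfV ?gt_eqF//.
have : 0 <= (p - 1) * (m - 1) by rewrite mulr_ge0; lra.
lra.
Qed.

End Extremal.

(** * The induction step *)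

Section Step.
Variable R : realType.
Implicit Types A B F G b c p g y al be rho : R.

Notation e := (expR 1 : R).
Notation tau := (tau R).

(** c stands for E S - u. The second inequality matters for A / F < [tau]; beyond [tau] it follows
    from the first, by [tail_bound_right]. *)
Definition tail_bound F A c : Prop :=
  - ln F * rate (A / F) - A / F <= c /\
  (F <= e^-1 -> (tau - 1) * (A / F - 1) - tau * A <= c).

Lemma tail_bound_right F A c : 0 < F -> tau <= A / F -> F <= e^-1 ->
  - ln F * rate (A / F) - A / F <= c -> (tau - 1) * (A / F - 1) - tau * A <= c.
Proof.
move=> F0 tr Fe; have [r Er] : exists r, A = r * F by exists (A / F); rewrite divfK// gt_eqF.
move: tr; rewrite Er mulfK ?gt_eqF// => tr.
have L1 : 1 <= - ln F by rewrite lerNr -ler_expR lnK// expRN.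
have := rate_chord tr L1; rewrite opprK lnK//.
lra.
Qed.

(* The case B / F <= (A / F) * (G / F), in which the ratio rho for the new sum is at
   most y = A / F. *)
Lemma tail_bound_step_light F y be g b p c rho :
  0 <= p <= 1 -> p * b <= 1 -> y - be <= b -> be <= y * g -> g <= 1 ->
  0 < 1 - p + p * g -> 0 < F <= 1 -> 0 < rho ->
  rho * (1 - p + p * g) = (1 - p) * y + p * be -> - (y * F) <= c ->
  - ln F * rate y - y <= c ->
  (F <= e^-1 -> (tau - 1) * (y - 1) - tau * (y * F) <= c) ->
  (1 < rho ->
    (- ln F - ln (1 - p + p * g)) * rate rho - rho <= c + p * b) /\
  (rho < tau -> (tau - 1) * (rho - 1) - tau * (rho * ((1 - p + p * g) * F)) <= c + p * b).
Proof.
move=> /andP[p0 p1] pb1 ybe h g1 s0 /andP[F0 F1] r0 Erho cA HF1 HF2.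
have ry : rho <= y.
  rewrite -(ler_pM2r s0) Erho; have := ler_wpM2l p0 h; lra.
(* Since c + p b = (c + y) - rho + t, [t] is the budget left for the factor 1 - p + p g of the new
   probability; [st] is what Bernoulli's inequality needs to stay within it. *)
set t := p * b - y + rho.
have st : p * (1 - g) * rho <= t.
  have := ler_wpM2l p0 ybe; rewrite /t; clear -Erho; lra.
have t0 : 0 <= t.
  by apply: le_trans st; rewrite !mulr_ge0// ?subr_ge0// ltW.
have tpb : t <= 1 by rewrite /t; clear -ry pb1; lra.
have -> : p * b = t + y - rho by rewrite /t; ring.
have t01 : 0 <= t <= 1 by rewrite t0.
split=> [r1|rt].
  have rr0 : 0 <= rate rho by apply/rate_ge0/ltW.
  have hb : - ln (1 - p + p * g) * rate rho <= t.
    have := ln_bernoulli r1 t01 st.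
    have -> : 1 - p * (1 - g) = 1 - p + p * g by ring.
    move=> /(ler_wpM2r rr0) hb; apply: le_trans hb _.
    by rewrite -mulrA mulrC ler_piMl// mulrC rate_mul_ell.
  have L0 : 0 <= - ln F by rewrite oppr_ge0 ln_le0.
  have := ler_wpM2l L0 (rate_le r0 ry).
  clear -hb HF1; lra.
have t1 := tau_gt1 R; have t2 := tau_le2 R.
have tF : 0 <= tau * F by rewrite mulr_ge0// ltW// tau_gt0.
have F1' : 0 <= 1 - F by rewrite subr_ge0.
have tsF := ler_wpM2l tF st.
have vy := ler_wpM2r F1' ry.
suff : tau * (rho * (1 - F)) + tau * F * t - (tau - 1) <= c + y + t by clear -tsF; lra.
(* Put v = rho (1 - F). If v <= 1, bounding c + y below by v leaves a claim affine in t: it is clear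
   at t = 0 and is [hr] at t = 1. *)
have [v1|v1] := leP (rho * (1 - F)) 1.
  have hr : (tau - 1) * (rho * (1 - F)) <= tau * (1 - F).
    rewrite mulrA ler_wpM2r//.
    have tm1 : 0 <= tau - 1 by clear -t1; lra.
    have tm2 : 0 <= tau by clear -t1; lra.
    have := ler_wpM2l tm1 (ltW rt).
    have := ler_wpM2l tm2 t2.
    clear; lra.
  have h0 : 0 <= (1 - t) * ((tau - 1) * (1 - rho * (1 - F))).
    by rewrite !mulr_ge0 ?subr_ge0// ltW.
  have := ler_wpM2l t0 hr.
  clear -h0 vy cA; lra.
(* Here 1 / rho < 1 - F, and rho < [tau] forces F below 1 / e, so the linear inequality for F is
   available. *)
have Fe : F <= e^-1.
  have : rho^-1 < 1 - F by rewrite -div1r ltr_pdivrMr// mulrC.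
  have : tau^-1 <= rho^-1 by rewrite lef_pV2 ?posrE ?tau_gt0// ltW.
  by rewrite tauV; clear; lra.
have tFe : tau * F <= 1.
  have : tau * F <= tau * e^-1 by rewrite ler_pM2l// tau_gt0.
  by rewrite tau_mulV; clear -t2; lra.
have := HF2 Fe; have := ler_wpM2r t0 tFe.
have := ler_wpM2l (ltW (tau_gt0 R)) vy.
clear; lra.
Qed.

(* The case y < al = B / G: the claims for (F, A) and (G, B) are averaged with
   weights 1 - p and p, so that b disappears. *)
Lemma tail_bound_step_heavy F y al g b p c rho :
  0 <= p <= 1 -> 0 < g <= 1 -> 0 < y -> y < al -> g * al <= y ->
  0 < F <= 1 -> 0 < 1 - p + p * g ->
  rho * (1 - p + p * g) = (1 - p) * y + p * (g * al) ->
  - (y * F) <= c ->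
  - ln F * rate y - y <= c ->
  (F <= e^-1 -> (tau - 1) * (y - 1) - tau * (y * F) <= c) ->
  - ln (g * F) * rate al - al <= c + b ->
  (g * F <= e^-1 -> (tau - 1) * (al - 1) - tau * (al * (g * F)) <= c + b) ->
  (1 < rho ->
    (- ln F - ln (1 - p + p * g)) * rate rho - rho <= c + p * b) /\
  (rho < tau -> (1 - p + p * g) * F <= e^-1 ->
    (tau - 1) * (rho - 1) - tau * (rho * ((1 - p + p * g) * F)) <= c + p * b).
Proof.
move=> /andP[p0 p1] /andP[g0 g1] y0 yal gal /andP[F0 F1] s0 Erho cA HF1 HF2 HG1 HG2.
have p1' : 0 <= 1 - p by rewrite subr_ge0.
have g1' : 0 <= 1 - g by rewrite subr_ge0.
have t1 := tau_gt1 R; have t2 := tau_le2 R.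
have yr : y <= rho.
  rewrite -(ler_pM2r s0) Erho.
  have := ler_wpM2l (mulr_ge0 p0 (ltW g0)) (ltW yal); clear; lra.
have ral : rho <= al.
  rewrite -(ler_pM2r s0) Erho.
  have := ler_wpM2l p1' (ltW yal); clear; lra.
have r0 : 0 < rho by apply: lt_le_trans yr.
have al0 : 0 < al by apply: lt_trans yal.
(* Averaging produces (1 - p) y + p al in place of rho. In the first claim this excess is paid for
   by the slope of [rate] and 1 - g <= - ln g; in the second its sign is favourable. *)
have Eid : (1 - p) * y + p * al - rho = p * (1 - g) * (al - rho).
  by move: Erho; clear; lra.
have pg : 0 <= p * (1 - g) * (al - rho) by rewrite !mulr_ge0// subr_ge0.
split=> [r1|rt Fe].
  have rr0 : 0 <= rate rho by apply/rate_ge0/ltW.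
  have L0 : 0 <= - ln F by rewrite oppr_ge0 ln_le0.
  have cvx : rate rho <= (1 - p) * rate y + p * rate al.
    apply: rate_convex; rewrite ?p0 ?p1//.
    rewrite -[leRHS]div1r ler_pdivlMr// -(ler_pM2r s0) mul1r -mulrA Erho.
    rewrite -subr_ge0.
    have -> : 1 - p + p * g - ((1 - p) / y + p / al) * ((1 - p) * y + p * (g * al)) =
        p * (1 - p) * ((al - y) * (y - g * al)) / (y * al).
      by field; rewrite !gt_eqF.
    apply: divr_ge0; last by rewrite mulr_ge0// ltW.
    by rewrite !mulr_ge0// subr_ge0// ltW.
  have hx : - ln (1 - p + p * g) <= p * - ln g.
    by rewrite mulrN lerN2 ln_weighted_le// p0.
  have hg : 1 - g <= - ln g.
    have := @le_ln1Dx R (g - 1); rewrite (addrC 1) subrK => /(_ _) hg.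
    by rewrite -opprB lerN2 hg// ltrBrDl subrr.
  have hinc := rate_increment r1 ral.
  rewrite lnM ?posrE// in HG1.
  have a1 := ler_wpM2l p1' HF1; have a2 := ler_wpM2l p0 HG1.
  have a3 := ler_wpM2l L0 cvx.
  have a4 := ler_wpM2r rr0 hx.
  have lg0 : 0 <= - ln g by apply: le_trans hg.
  have a5 := ler_wpM2l (mulr_ge0 p0 lg0) hinc.
  have ar0 : 0 <= al - rho by rewrite subr_ge0.
  have a6 := ler_wpM2r ar0 (ler_wpM2l p0 hg).
  clear -a1 a2 a3 a4 a5 a6 Eid; lra.
have tm1 : 0 <= tau - 1 by rewrite subr_ge0 ltW.
(* F may exceed 1 / e although the new probability does not. Then y < [tau] and 1 - F <= 1 / [tau],
   and the inequality follows from - A <= c. *)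
have cF : (tau - 1) * (y - 1) - tau * (y * F) <= c.
  have [Fe'|Fe'] := leP F e^-1; first exact: HF2.
  apply: le_trans cA.
  have F1' : 0 <= 1 - F by rewrite subr_ge0.
  have h1 : y * (1 - F) <= 1.
    apply: (@le_trans _ _ (tau * tau^-1)); last by rewrite mulfV// gt_eqF// tau_gt0.
    rewrite ler_pM//; [exact: ltW|lra|].
    by rewrite tauV lerD2l lerN2 ltW.
  have := ler_wpM2l tm1 h1; clear; lra.
have GF' : g * F <= e^-1.
  apply: le_trans Fe; rewrite ler_pM2r//.
  have := ler_wpM2l p1' g1; clear; lra.
have a1 := ler_wpM2l p1' cF; have a2 := ler_wpM2l p0 (HG2 GF').
have a3 := mulr_ge0 tm1 pg.
have a4 : tau * (rho * ((1 - p + p * g) * F)) = tau * (((1 - p) * y + p * (g * al)) * F).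
  by rewrite -Erho; ring.
rewrite -Eid in a3; rewrite a4.
clear -a1 a2 a3; lra.
Qed.

(** F, A belong to the threshold u and G, B to u - b. Everything is divided by F, with y = A / F, g
    = G / F, be = B / F, and rho the ratio of the new pair; the split is on be <= y g. *)
Lemma tail_bound_step F A G B b p c :
  0 <= p <= 1 -> p * b <= 1 -> F <= 1 -> 0 <= G <= F ->
  (0 < F -> 0 < A) -> 0 <= B <= A -> A - B <= b * F ->
  (0 < G -> 0 < B) -> (G = 0 -> B = 0) ->
  - A <= c -> - B <= c + b ->
  (0 < F -> tail_bound F A c) -> (0 < G -> tail_bound G B (c + b)) ->
  0 < (1 - p) * F + p * G ->
  tail_bound ((1 - p) * F + p * G) ((1 - p) * A + p * B) (c + p * b).
Proof.
move=> p01 pb1 F1 /andP[G0 GF] FA /andP[B0 BA] AB GB0 GB cA cB.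
have [p0 p1] := andP p01; have p1' : 0 <= 1 - p by rewrite subr_ge0.
have [F0|F0] := ltP 0 F; last first.
  have -> : F = 0 by apply/eqP; rewrite eq_le F0 (le_trans G0).
  rewrite (_ : G = 0) ?mulr0 ?addr0 ?ltxx//.
  by apply/eqP; rewrite eq_le G0 (le_trans GF).
move=> /(_ isT) HF HG F'0; have A0 := FA F0.
have A'0 : 0 < (1 - p) * A + p * B.
  have [p1e|p1n] := eqVneq p 1.
    move: F'0; rewrite p1e subrr !mul0r !add0r !mul1r; exact: GB0.
  rewrite ltr_pwDl ?mulr_ge0// mulr_gt0// subr_gt0 lt_neqAle p1n//.
have F'1 : (1 - p) * F + p * G <= 1.
  have := ler_wpM2l p1' F1; have := ler_wpM2l p0 (le_trans GF F1); clear; lra.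
have cAB : - ((1 - p) * A + p * B) <= c + p * b.
  have := ler_wpM2l p1' cA; have := ler_wpM2l p0 cB; clear; lra.
have L'0 : 0 <= - ln ((1 - p) * F + p * G) by rewrite oppr_ge0 ln_le0.
have [rho Erho] : exists rho, (1 - p) * A + p * B = rho * ((1 - p) * F + p * G).
  exists (((1 - p) * A + p * B) / ((1 - p) * F + p * G)).
  by rewrite divfK// gt_eqF.
have [y Ey] : exists y, A = y * F by exists (A / F); rewrite divfK// gt_eqF.
have [g Eg] : exists g, G = g * F by exists (G / F); rewrite divfK// gt_eqF.
have [be Ebe] : exists be, B = be * F by exists (B / F); rewrite divfK// gt_eqF.
have y0 : 0 < y by rewrite -(pmulr_lgt0 _ F0) -Ey.
have g0 : 0 <= g by rewrite -(pmulr_lge0 _ F0) -Eg.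
have g1 : g <= 1 by rewrite -(ler_pM2r F0) -Eg mul1r.
have bey : be <= y by rewrite -(ler_pM2r F0) -Ebe -Ey.
have ybe : y - be <= b by rewrite -(ler_pM2r F0) mulrBl -Ebe -Ey.
have F's : (1 - p) * F + p * G = (1 - p + p * g) * F by rewrite Eg; ring.
have s0 : 0 < 1 - p + p * g by rewrite -(pmulr_lgt0 _ F0) -F's.
have lnF' : ln ((1 - p) * F + p * G) = ln F + ln (1 - p + p * g).
  by rewrite F's mulrC lnM.
have Erho' : rho * (1 - p + p * g) = (1 - p) * y + p * be.
  apply: (mulIf (lt0r_neq0 F0)); rewrite -mulrA -F's -Erho Ey Ebe; ring.
have rho0 : 0 < rho by rewrite -(pmulr_lgt0 _ F'0) -Erho.
have F01 : 0 < F <= 1 by rewrite F0.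
have Erh : ((1 - p) * A + p * B) / ((1 - p) * F + p * G) = rho.
  by rewrite Erho mulfK// gt_eqF.
have [HF1 HF2] := HF; rewrite Ey mulfK ?gt_eqF// in HF1 HF2.
suff [H1 H2] :
    (1 < rho -> (- ln F - ln (1 - p + p * g)) * rate rho - rho <= c + p * b) /\
    (rho < tau -> (1 - p + p * g) * F <= e^-1 ->
      (tau - 1) * (rho - 1) - tau * (rho * ((1 - p + p * g) * F)) <= c + p * b).
  have H1' : - ln ((1 - p) * F + p * G) * rate rho - rho <= c + p * b.
    (* For rho <= 1 the value of [rate] is nonpositive, and [cAB] suffices. *)
    have [r1|r1] := leP rho 1; last by rewrite lnF' opprD; exact: H1.
    have rn : rate rho <= 0 by apply: rate_le0; rewrite rho0.
    apply: le_trans cAB; rewrite Erho.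
    have := mulr_ge0_le0 L'0 rn.
    have := ler_wpM2l (ltW rho0) F'1.
    clear; lra.
  split; first by rewrite Erh.
  move=> Fe; have [tr|tr] := leP tau rho.
    by apply: tail_bound_right => //; rewrite Erh.
  by rewrite Erh Erho F's; apply: H2; rewrite -?F's.
rewrite Ey in cA.
have [h|h] := leP be (y * g).
  have [H1 H2] := tail_bound_step_light p01 pb1 ybe h g1 s0 F01 rho0 Erho' cA HF1 HF2.
  by split=> // /H2.
have gp : 0 < g.
  rewrite lt_neqAle g0 andbT; apply/eqP => g00.
  have : B = 0 by apply: GB; rewrite Eg -g00 mul0r.
  move=> BE; move: h; rewrite -g00 mulr0 => be0.
  by move: BE; rewrite Ebe => /eqP; rewrite mulf_eq0 !gt_eqF.
have Gp : 0 < G by rewrite Eg mulr_gt0.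
have [HG1 HG2] := HG Gp.
have Eal : be = g * (be / g) by rewrite mulrCA mulfV ?mulr1// gt_eqF.
have EBG : B / G = be / g by rewrite Ebe Eg; field; rewrite !gt_eqF.
rewrite EBG Eg in HG1 HG2.
apply: (tail_bound_step_heavy (y := y) (al := be / g) (b := b)) => //.
- by rewrite gp.
- by rewrite ltr_pdivlMr.
- by rewrite -Eal.
- by rewrite -Eal.
- by have -> : be / g * (g * F) = B by rewrite mulrA divfK ?gt_eqF.
Qed.
End Step.

(** * Sums of two-point variables *)

Section TwoPoint.
Variable R : realType.
Implicit Types (l : seq (R * R)) (u v : R).

Notation e := (expR 1 : R).
Notation tau := (tau R).

(* The list l encodes a sum S of independent variables, one for each pair (b, p),
   equal to b with probability p and to 0 otherwise; tp_prob l u is P(S < u) and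
   tp_slack l u is E(u - S)^+. *)
Fixpoint tp_prob l u : R := match l with
  | [::] => (0 < u)%R%:R
  | (b, p) :: l' => (1 - p) * tp_prob l' u + p * tp_prob l' (u - b)
  end.

Fixpoint tp_slack l u : R := match l with
  | [::] => Num.max 0 u
  | (b, p) :: l' => (1 - p) * tp_slack l' u + p * tp_slack l' (u - b)
  end.

Definition tp_mean l : R := \sum_(x <- l) x.2 * x.1.

Definition tp_wf l := all (fun x : R * R => [&& 0 <= x.1, 0 <= x.2 <= 1 & x.2 * x.1 <= 1]) l.

Lemma tp_wf_cons b p l : tp_wf ((b, p) :: l) ->
  [/\ 0 <= b, 0 <= p <= 1, p * b <= 1 & tp_wf l].
Proof. by rewrite /tp_wf/= => /andP[/and3P[-> -> ->] ->]. Qed.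

Lemma tp_prob_ge0 l u : tp_wf l -> 0 <= tp_prob l u.
Proof.
elim: l u => [|[b p] l IH] u /=; first by case: (0 < u).
move=> /tp_wf_cons[_ /andP[p0 p1] _ wl].
by rewrite addr_ge0// mulr_ge0// ?IH// subr_ge0.
Qed.

Lemma tp_prob_le1 l u : tp_wf l -> tp_prob l u <= 1.
Proof.
elim: l u => [|[b p] l IH] u /=; first by case: (0 < u).
move=> /tp_wf_cons[_ /andP[p0 p1] _ wl].
have p1' : 0 <= 1 - p by rewrite subr_ge0.
have := ler_wpM2l p1' (IH u wl); have := ler_wpM2l p0 (IH (u - b) wl); lra.
Qed.

Lemma tp_prob_le l u v : tp_wf l -> u <= v -> tp_prob l u <= tp_prob l v.
Proof.
elim: l u v => [|[b p] l IH] u v /=.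
  move=> _ uv; have [u0|u0] := ltP 0 u; last exact: ler0n.
  by rewrite (lt_le_trans u0 uv).
move=> /tp_wf_cons[_ /andP[p0 p1] _ wl] uv.
by rewrite lerD// ler_wpM2l// ?subr_ge0// IH// lerD2r.
Qed.

Lemma tp_slack_ge0 l u : tp_wf l -> 0 <= tp_slack l u.
Proof.
elim: l u => [|[b p] l IH] u /=; first by rewrite le_max lexx.
move=> /tp_wf_cons[_ /andP[p0 p1] _ wl].
by rewrite addr_ge0// mulr_ge0// ?IH// subr_ge0.
Qed.

Lemma tp_slack_le0 l u : tp_wf l -> u <= 0 -> tp_slack l u = 0.
Proof.
elim: l u => [|[b p] l IH] u /=; first by move=> _ u0; rewrite max_l.
move=> /tp_wf_cons[b0 _ _ wl] u0.
by rewrite !IH ?mulr0 ?addr0//; lra.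
Qed.

Lemma tp_slack_le l u v : tp_wf l -> u <= v -> tp_slack l u <= tp_slack l v.
Proof.
elim: l u v => [|[b p] l IH] u v /=.
  by move=> _ uv; rewrite ge_max !le_max lexx uv orbT.
move=> /tp_wf_cons[_ /andP[p0 p1] _ wl] uv.
by rewrite lerD// ler_wpM2l// ?subr_ge0// IH// lerD2r.
Qed.

(** The function u |-> E(u - S)^+ is convex with left derivative P(S < u). *)
Lemma tp_slack_increment l u v : tp_wf l -> v <= u ->
  tp_slack l u - tp_slack l v <= (u - v) * tp_prob l u.
Proof.
elim: l u v => [|[b p] l IH] u v /=.
  move=> _ vu; have [u0|u0] := ltP 0 u.
    have [v0|v0] := ltP 0 v; rewrite mulr1 /Num.max; last first.
      by rewrite lerD2l oppr0 oppr_ge0.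
    by [].
  by rewrite !max_l ?mulr0 ?subrr// (le_trans vu).
move=> /tp_wf_cons[_ /andP[p0 p1] _ wl] uv.
have p1' : 0 <= 1 - p by rewrite subr_ge0.
have uvb : v - b <= u - b by rewrite lerD2r.
have := ler_wpM2l p1' (IH _ _ wl uv); have := ler_wpM2l p0 (IH _ _ wl uvb); lra.
Qed.

Lemma tp_slack_le_prob l u : tp_wf l -> 0 <= u -> tp_slack l u <= u * tp_prob l u.
Proof.
move=> wl u0; have := tp_slack_increment wl u0.
by rewrite (tp_slack_le0 wl (lexx 0)) !subr0.
Qed.

Lemma tp_slack_ge l u : tp_wf l -> u - tp_mean l <= tp_slack l u.
Proof.
elim: l u => [|[b p] l IH] u.
  by move=> _; rewrite /tp_mean big_nil subr0/= le_max lexx orbT.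
move=> /tp_wf_cons[_ /andP[p0 p1] _ wl]; rewrite /tp_mean big_cons/= -/(tp_mean l).
have p1' : 0 <= 1 - p by rewrite subr_ge0.
have := ler_wpM2l p1' (IH u wl); have := ler_wpM2l p0 (IH (u - b) wl); lra.
Qed.

Lemma tp_slack_gt0 l u : tp_wf l -> 0 < tp_prob l u -> 0 < tp_slack l u.
Proof.
elim: l u => [|[b p] l IH] u /=.
  by move=> _; rewrite lt_max ltxx/=; case: (0 < u)%R; rewrite ?ltxx.
move=> /tp_wf_cons[_ /andP[p0 p1] _ wl].
have p1' : 0 <= 1 - p by rewrite subr_ge0.
have s1 := tp_slack_ge0 u wl; have s2 := tp_slack_ge0 (u - b) wl.
have f1 := tp_prob_ge0 u wl; have f2 := tp_prob_ge0 (u - b) wl.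
have h (q f s : R) : 0 <= q -> 0 <= f -> (0 < f -> 0 < s) -> 0 < q * f -> 0 < q * s.
  move=> q0 f0 fs qf; rewrite mulr_gt0//.
    by rewrite lt_neqAle q0 andbT; apply/eqP => qE; rewrite -qE mul0r ltxx in qf.
  apply: fs; rewrite lt_neqAle f0 andbT; apply/eqP => fE.
  by rewrite -fE mulr0 ltxx in qf.
have [H _|H] := ltP 0 ((1 - p) * tp_prob l u).
  by rewrite ltr_pwDl ?mulr_ge0// (h _ _ _ p1' f1 (IH u wl)).
move=> H2; rewrite ltr_wpDl ?mulr_ge0//.
by apply: (h _ _ _ p0 f2 (IH (u - b) wl)); lra.
Qed.

Lemma tp_tail_bound l u : tp_wf l -> 0 < tp_prob l u ->
  tail_bound (tp_prob l u) (tp_slack l u) (tp_mean l - u).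
Proof.
elim: l u => [|[b p] l IH] u.
  rewrite /tp_mean big_nil /= => _.
  (* For the empty sum F = 1: the first inequality is an equality and the second is void since 1 > 1
     / e. *)
  have [u0 _|u0] := ltP 0 u; last by rewrite ltxx.
  rewrite /tail_bound ln1 oppr0 mul0r divr1 !sub0r lexx; split=> //.
  rewrite invf_ge1 ?expR_gt0// => e1.
  by have := expR1_gt2 R; lra.
move=> wl'; have [b0 p01 pb1 wl] := tp_wf_cons wl'.
have ubu : u - b <= u by rewrite lerBlDr lerDl.
have -> : tp_mean ((b, p) :: l) - u = tp_mean l - u + p * b.
  by rewrite /tp_mean big_cons/=; ring.
move=> /= F'0; apply: tail_bound_step => //.
- exact: tp_prob_le1.
- by rewrite tp_prob_ge0//= tp_prob_le.
- exact: tp_slack_gt0.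
- by rewrite tp_slack_ge0//= tp_slack_le.
- by have := tp_slack_increment wl ubu; rewrite subKr.
- exact: tp_slack_gt0.
- have [h|h] := leP (u - b) 0; first by rewrite tp_slack_le0.
  move=> G0; apply/eqP; rewrite eq_le tp_slack_ge0// andbT.
  by apply: le_trans (tp_slack_le_prob wl (ltW h)) _; rewrite G0 mulr0.
- by have := tp_slack_ge u wl; lra.
- by have := tp_slack_ge (u - b) wl; lra.
- exact: IH.
- by rewrite (_ : tp_mean l - u + b = tp_mean l - (u - b)); [exact: IH|ring].
Qed.

(** m will be the number of variables. Up to r = 1 + delta the identity F = A / r suffices; beyond
    [tau] the first inequality is combined with quasiconvexity on [1 + delta, m + delta]; in between
    the linear inequality is used. *)
Lemma tp_prob_ge l m delta : tp_wf l -> tp_mean l <= m -> 0 < delta ->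
  Num.min (delta / (1 + delta)) (expR (- (m * ell (m + delta)))) <=
    tp_prob l (tp_mean l + delta).
Proof.
move=> wl Mm d0; set u := tp_mean l + delta.
have M0 : 0 <= tp_mean l.
  rewrite /tp_mean big_seq; apply: sumr_ge0 => x xl.
  by have /allP/(_ x xl)/and3P[x1 /andP[x2 _] _] := wl; rewrite mulr_ge0.
have u0 : 0 < u by rewrite ltr_wpDl.
have Ad : delta <= tp_slack l u by have := tp_slack_ge u wl; rewrite /u; lra.
have AF := tp_slack_le_prob wl (ltW u0).
have F0 : 0 < tp_prob l u.
  by rewrite -(pmulr_rgt0 _ u0) (lt_le_trans _ AF)// (lt_le_trans d0).
have [] := tp_tail_bound wl F0.
have t1 := tau_gt1 R; have t0 := tau_gt0 R.
have Ec : tp_mean l - u = - delta by rewrite /u; ring.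
rewrite Ec; move: (tp_prob l u) (tp_slack l u) Ad AF F0 => F A Ad AF F0.
have [r Er] : exists r, A = r * F by exists (A / F); rewrite divfK// gt_eqF.
have ru : r <= u by rewrite -(ler_pM2r F0) -Er.
rewrite Er mulfK ?gt_eqF// => H1 H2.
have d1 : 0 < 1 + delta by lra.
rewrite ge_min.
have [r1|r1] := leP r (1 + delta).
  apply/orP; left; rewrite ler_pdivrMr//.
  apply: (le_trans Ad); rewrite Er mulrC ler_wpM2l// ltW//.
have r0 : 0 < r by lra.
have [tr|tr] := leP tau r.
  have L : - ln F <= (r - delta) * ell r.
    have e0 : 0 < ell r by apply: ell_gt0; lra.
    by rewrite -ler_pdivrMr// -rate_right//; lra.
  have rmd : r <= m + delta by apply: le_trans ru _; rewrite /u lerD2r.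
  have a1 : 1 < 1 + delta by lra.
  have := le_trans L (ell_quasiconvex delta a1 (ltW r1) rmd).
  rewrite !addrK mul1r le_max => /orP[h|h]; apply/orP; [left|right].
    have -> : delta / (1 + delta) = expR (- ell (1 + delta)).
      by rewrite expR_ell//; field; rewrite gt_eqF.
    by rewrite -[leRHS]lnK// ler_expR lerNl.
  by rewrite -[leRHS]lnK// ler_expR lerNl.
(* Now 1 + delta < r < [tau], hence delta / (1 + delta) <= 1 / e, which settles F > 1 / e. *)
apply/orP; left.
have dE : delta / (1 + delta) = 1 - (1 + delta)^-1 by field; rewrite gt_eqF.
have [Fe|Fe] := leP F e^-1; last first.
  apply: le_trans (ltW Fe).
  have : tau^-1 <= (1 + delta)^-1 by rewrite lef_pV2 ?posrE// ltW// (lt_trans r1).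
  by rewrite tauV dE; lra.
have h := H2 Fe.
(* Multiplied by 1 + delta, the linear inequality gives the claim with exactly this product to
   spare. *)
have hh : 0 <= (tau - 1 - delta) * (r - 1 - delta).
  by apply: mulr_ge0; lra.
rewrite ler_pdivrMr// -(ler_pM2r (mulr_gt0 t0 r0)).
have := ler_wpM2r (ltW d1) h.
lra.
Qed.

End TwoPoint.

(** * Finite laws *)

Section FiniteLaws.
Variables (R : realType) (T : finType).

(** Among laws with a given mean a two-point law minimizes E G: the lower convex hull of the points
    (v j, G j) is met above the mean on a segment. The order v a <= v b keeps the increment v b - v
    a nonnegative in [fin_expect_ge]. *)
Lemma chord_le (w v G : T -> R) : (forall j, 0 <= w j) -> \sum_j w j = 1 ->
  exists a b theta, [/\ 0 <= theta <= 1, v a <= v b,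
    (1 - theta) * v a + theta * v b = \sum_j w j * v j &
    (1 - theta) * G a + theta * G b <= \sum_j w j * G j].
Proof.
move=> w0 w1; set m := \sum_j w j * v j; set S := \sum_j w j * G j.
pose x j := v j - m; pose H j := G j - S.
have wx : \sum_j w j * x j = 0.
  under eq_bigr do rewrite /x mulrBr.
  by rewrite sumrB -mulr_suml w1 mul1r subrr.
have wH : \sum_j w j * H j = 0.
  under eq_bigr do rewrite /H mulrBr.
  by rewrite sumrB -mulr_suml w1 mul1r subrr.
have wN0 : ~ (forall j, w j = 0).
  by move=> h; move: w1; rewrite big1// => /esym/eqP; rewrite oner_eq0.
(* If no value exceeds the mean, all the mass sits at the mean and a = b works. *)
have [[k0 xk0]|Hn] := pselect (exists k, 0 < x k); last first.
  have xle j : x j <= 0 by rewrite leNgt; apply/negP => xj; apply: Hn; exists j.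
  have wx0 j : w j * x j = 0.
    apply/eqP; rewrite -oppr_eq0; apply/eqP.
    apply: (@psumr_eq0P _ _ xpredT (fun j => - (w j * x j))) => //.
      by move=> i _; rewrite oppr_ge0 mulr_ge0_le0.
    by rewrite sumrN wx oppr0.
  have [[j [xj Hj]]|Hnn] := pselect (exists j, x j = 0 /\ H j <= 0).
    exists j, j, 0; split=> //; first by rewrite lexx ler01.
      by rewrite subr0 mul1r mul0r addr0; move: xj; rewrite /x; lra.
    by rewrite subr0 mul1r mul0r addr0; move: Hj; rewrite /H; lra.
  exfalso; apply: wN0 => j.
  have wj0 i : x i != 0 -> w i = 0.
    by move=> xi; move/eqP: (wx0 i); rewrite mulf_eq0 (negbTE xi) orbF => /eqP.
  have Hpos i : x i = 0 -> 0 < H i.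
    by move=> xi; rewrite ltNge; apply/negP => Hi; apply: Hnn; exists i.
  have [xj|xj] := eqVneq (x j) 0; last exact: wj0.
  have /eqP : w j * H j = 0.
    apply: (@psumr_eq0P _ _ xpredT (fun j => w j * H j)) => // i _.
    have [xi|xi] := eqVneq (x i) 0; first by rewrite mulr_ge0// ltW// Hpos.
    by rewrite wj0// mul0r.
  by rewrite mulf_eq0 (gt_eqF (Hpos _ xj)) orbF => /eqP.
(* The chord issuing from the point of smallest slope H k / x k among those with
   x k > 0 lies below the average value at m. *)
case: (@arg_minP _ _ _ k0 (fun k => 0 < x k) (fun k => H k / x k) xk0) => k xk kmin.
set c := H k / x k.
have Kge j : 0 < x j -> 0 <= H j - c * x j.
  by move=> xj; rewrite subr_ge0 -ler_pdivlMr//; exact: kmin.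
(* Otherwise H - c x, which has average 0, is positive where x <= 0 and nonnegative elsewhere. So w
   vanishes where x <= 0, and then everywhere because x has average 0. *)
have [[j [xj Hj]]|Hnn] := pselect (exists j, x j <= 0 /\ H j <= c * x j); last first.
  exfalso; apply: wN0.
  have Kpos i : x i <= 0 -> 0 < H i - c * x i.
    by move=> xi; rewrite subr_gt0 ltNge; apply/negP => Hi; apply: Hnn; exists i.
  have wK j : w j * (H j - c * x j) = 0.
    apply: (@psumr_eq0P _ _ xpredT (fun j => w j * (H j - c * x j))) => //.
      move=> i _; rewrite mulr_ge0//.
      by have [/Kpos/ltW|/Kge] := leP (x i) 0.
    under eq_bigr do rewrite mulrBr (mulrCA _ c).
    by rewrite sumrB -mulr_sumr wx wH mulr0 subr0.
  have wj0 i : x i <= 0 -> w i = 0.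
    move=> xi; move/eqP: (wK i); rewrite mulf_eq0 (gt_eqF (Kpos _ xi)) orbF.
    by move/eqP.
  move=> j; have [|xj] := leP (x j) 0; first exact: wj0.
  have /eqP : w j * x j = 0.
    apply: (@psumr_eq0P _ _ xpredT (fun j => w j * x j)) => // i _.
    have [xi|xi] := leP (x i) 0; first by rewrite wj0// mul0r.
    by rewrite mulr_ge0// ltW.
  by rewrite mulf_eq0 (gt_eqF xj) orbF => /eqP.
have d0 : 0 < x k - x j by rewrite subr_gt0 (le_lt_trans xj).
have Ek : H k = c * x k by rewrite /c divfK// gt_eqF.
exists j, k, (- x j / (x k - x j)); split.
- by rewrite divr_ge0 ?oppr_ge0 ?(ltW d0)//= ler_pdivrMr// mul1r lerDr ltW.
- by move: d0; rewrite /x; lra.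
- have vj : v j = x j + m by rewrite /x subrK.
  have vk : v k = x k + m by rewrite /x subrK.
  by rewrite vj vk; field; rewrite gt_eqF.
have Gj : G j = H j + S by rewrite /H subrK.
have Gk : G k = H k + S by rewrite /H subrK.
rewrite Gj Gk -(ler_pM2r d0).
have -> : ((1 - - x j / (x k - x j)) * (H j + S) +
   - x j / (x k - x j) * (H k + S)) * (x k - x j) =
   x k * H j - x j * H k + S * (x k - x j).
  by field; rewrite gt_eqF.
have := ler_wpM2l (ltW xk) Hj.
by rewrite Ek; lra.
Qed.

Variables (v : T -> R) (w : nat -> T -> R).

(* E g(u - S) for a sum S of k independent variables, the i-th one taking the
   value v j with probability w i j. *)
Fixpoint fin_expect (k : nat) (g : R -> R) (u : R) : R :=
  if k is k'.+1 then \sum_j w k' j * fin_expect k' g (u - v j) else g u.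

Lemma fin_expect_lin k (g : R -> R) c d b u :
  fin_expect k (fun u => c * g u + d * g (u - b)) u =
  c * fin_expect k g u + d * fin_expect k g (u - b).
Proof.
elim: k u => [//|k IH] u /=.
rewrite !mulr_sumr -big_split/=; apply: eq_bigr => j _.
by rewrite IH [u - v j - b]addrAC; ring.
Qed.

Lemma fin_expect_le k g u u' : (forall i j, (i < k)%N -> 0 <= w i j) ->
  {homo g : x y / x <= y} -> u <= u' -> fin_expect k g u <= fin_expect k g u'.
Proof.
move=> w0 gm; elim: k u u' w0 => [|k IH] u u' w0 uu' /=; first exact: gm.
apply: ler_sum => j _; rewrite ler_wpM2l ?w0// IH// ?lerD2r// => i j' ik.
by rewrite w0// ltnW.
Qed.

Definition fin_mean i := \sum_j w i j * v j.

(** [t] lists the variables already replaced. The last remaining one gets the two-point law of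
    [chord_le]; its smaller value v a is absorbed into the threshold, leaving the entry (v b - v a,
    th). *)
Lemma fin_expect_ge k t (m delta : R) : (forall j, 0 <= v j) ->
  (forall i j, (i < k)%N -> 0 <= w i j) ->
  (forall i, (i < k)%N -> \sum_j w i j = 1) ->
  (forall i, (i < k)%N -> fin_mean i <= 1) ->
  tp_wf t -> \sum_(i < k) fin_mean i + tp_mean t <= m -> 0 < delta ->
  Num.min (delta / (1 + delta)) (expR (- (m * ell (m + delta)))) <=
    fin_expect k (tp_prob t) (\sum_(i < k) fin_mean i + tp_mean t + delta).
Proof.
move=> v0 + + + + + d0; elim: k t => [t _ _ _ wt|k IH t w0 w1 wm wt].
  by rewrite big_ord0 add0r => ?; exact: tp_prob_ge.
rewrite big_ord_recr /= => Mm.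
set u := _ + _ + _ + delta.
have [a [b [th [/andP[th0 th1] ab E h]]]] :=
  chord_le v (fun j => fin_expect k (tp_prob t) (u - v j))
    (fun j => w0 k j (ltnSn k)) (w1 k (ltnSn k)).
apply: le_trans h.
have := IH ((v b - v a, th) :: t).
have mk := wm k (ltnSn k).
have Eth : th * (v b - v a) = fin_mean k - v a by rewrite /fin_mean -E; ring.
have tm : tp_mean ((v b - v a, th) :: t) = fin_mean k - v a + tp_mean t.
  by rewrite /tp_mean big_cons/= Eth.
have -> : \sum_(i < k) fin_mean i + tp_mean ((v b - v a, th) :: t) + delta = u - v a.
  by rewrite tm /u; ring.
rewrite /= fin_expect_lin.
have -> : u - v a - (v b - v a) = u - v b by ring.
apply.
- by move=> i j ik; apply: w0; rewrite ltnW.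
- by move=> i ik; apply: w1; rewrite ltnW.
- by move=> i ik; apply: wm; rewrite ltnW.
- rewrite /tp_wf/= subr_ge0 ab th0 th1 Eth /=; apply/andP; split=> //.
  by have := v0 a; lra.
- by rewrite tm; have := v0 a; lra.
Qed.

Lemma sum_ffun_rcons (V : nmodType) k (F : {ffun 'I_k.+1 -> T} -> V) :
  \sum_f F f = \sum_a \sum_(g : {ffun 'I_k -> T})
     F [ffun i => oapp g a (unlift ord_max i)].
Proof.
pose h (x : T * {ffun 'I_k -> T}) : {ffun 'I_k.+1 -> T} :=
  [ffun i => oapp x.2 x.1 (unlift ord_max i)].
rewrite pair_bigA/= (reindex h)//=.
exists (fun f => (f ord_max, [ffun i => f (lift ord_max i)])) => [[a g] _|f _] /=.
  rewrite /h/= ffunE unlift_none/=; congr (_, _).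
  by apply/ffunP => i; rewrite !ffunE liftK.
apply/ffunP => i; rewrite !ffunE/=.
by case: unliftP => [j ->|->]/=; rewrite ?ffunE.
Qed.

Lemma sum_ffun_fin_expect k (u : R) :
  \sum_(f : {ffun 'I_k -> T})
    (\prod_(i < k) w i (f i)) * ((\sum_(i < k) v (f i) < u)%R)%:R =
  fin_expect k (tp_prob [::]) u.
Proof.
elim: k u => [|k IH] u /=.
  rewrite (big_pred1 (ffun0 (card_ord 0))).
    by rewrite !big_ord0 mul1r.
  by move=> f; apply/esym/eqP/ffunP; case.
rewrite sum_ffun_rcons; apply: eq_bigr => a _.
rewrite -IH mulr_sumr; apply: eq_bigr => g _.
rewrite !big_ord_recr/= !ffunE unlift_none/=.
have Eg (i : 'I_k) : [ffun i => oapp g a (unlift ord_max i)] (widen_ord (leqnSn k) i) = g i.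
  rewrite ffunE (_ : widen_ord _ i = lift ord_max i) ?liftK//.
  by apply: val_inj; rewrite /= /bump leqNgt ltn_ord.
under eq_bigr do rewrite Eg.
under [X in _ * (X + _ < _)%R%:R]eq_bigr do rewrite Eg.
by rewrite ltrBrDr mulrA (mulrC (w k a)).
Qed.

End FiniteLaws.

(** * General laws *)

Section SimpleIntegral.
Context (R : realType) (d : measure_display) (T : measurableType d).
Variable (P : probability T R).

Lemma integral_weighted_indic (I : finType) (c : I -> R) (E : I -> set T) :
  (forall i, 0 <= c i) -> (forall i, measurable (E i)) ->
  (\int[P]_x (\sum_i c i * \1_(E i) x)%:E = (\sum_i c i * fine (P (E i)))%:E)%E.
Proof.
move=> c0 mE.
under eq_integral do rewrite -sumEFin.
rewrite ge0_integral_sum//=; last 2 first.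
- by move=> i; apply/measurable_EFinP; apply: measurable_funM => //; exact: measurable_indic.
- by move=> i x _; rewrite lee_fin mulr_ge0// indicE ler0n.
rewrite -sumEFin; apply: eq_bigr => i _.
under eq_integral do rewrite EFinM.
rewrite ge0_integralZl_EFin//=; last first.
  by apply/measurable_EFinP; exact: measurable_indic.
by rewrite integral_indic// setIT EFinM fineK// fin_num_measure.
Qed.

Lemma weighted_indic_le (I : finType) (c : I -> R) (E : I -> set T) (g : T -> R) :
  (forall i, 0 <= c i) -> (forall i, measurable (E i)) -> measurable_fun setT g ->
  (forall x, \sum_i c i * \1_(E i) x <= g x) ->
  ((\sum_i c i * fine (P (E i)))%:E <= \int[P]_x (g x)%:E)%E.
Proof.
move=> c0 mE mg cg; rewrite -integral_weighted_indic//.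
apply: ge0_le_integral => //=.
- by move=> x _; rewrite lee_fin sumr_ge0// => i _; rewrite mulr_ge0// indicE ler0n.
- apply/measurable_EFinP; apply: measurable_sum => i.
  by apply: measurable_funM => //; exact: measurable_indic.
- exact/measurable_EFinP.
- by move=> x _; rewrite lee_fin.
Qed.

End SimpleIntegral.

Section Discretization.
Variables (R : realType) (d : measure_display) (T : measurableType d).
Variables (P : probability T R) (n : nat) (X : 'I_n -> {RV P >-> R}).
Variables (I : finType) (B : I -> set R) (idx : R -> I) (v : I -> R).
Hypotheses (X0 : forall i w, 0 <= X i w).
Hypotheses (mB : forall j, measurable (B j)).
Hypothesis BE : forall x j, 0 <= x -> B j x <-> j = idx x.

Let cell (i : 'I_n) (j : I) := X i @^-1` B j.

Let mcell i j : measurable (cell i j).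
Proof. exact: measurable_funPTI. Qed.

Lemma indic_cell i j x : \1_(cell i j) x = (j == idx (X i x))%:R :> R.
Proof.
rewrite indicE; congr (_%:R); congr nat_of_bool.
apply/idP/eqP => [/set_mem|jE]; first by move/(BE _ (X0 i x)).
by apply/mem_set/(BE _ (X0 i x)).
Qed.

Lemma sum_cell (c : I -> R) i x : \sum_j c j * \1_(cell i j) x = c (idx (X i x)).
Proof.
rewrite (bigD1 (idx (X i x)))//= indic_cell eqxx mulr1 big1 ?addr0// => j jn.
by rewrite indic_cell (negbTE jn) mulr0.
Qed.

Lemma sum_prob_cell i : \sum_j fine (P (cell i j)) = 1.
Proof.
apply: EFin_inj.
rewrite -(probability_setT P) -[P setT]mul1e -integral_cst//.
transitivity (\int[P]_x (\sum_j 1 * \1_(cell i j) x)%:E)%E.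
  by rewrite integral_weighted_indic//; congr (_%:E); apply: eq_bigr => j _; rewrite mul1r.
by apply: eq_integral => x _; rewrite (sum_cell (fun=> 1)).
Qed.

Lemma mean_cell_le i (eps mu : R) : 0 <= eps -> (forall j, 0 <= v j) ->
  (forall x, 0 <= x -> v (idx x) <= x + eps) ->
  ('E_P[X i] = mu%:E)%E -> \sum_j fine (P (cell i j)) * v j <= mu + eps.
Proof.
move=> eps0 v0 vle Emu.
have : ((\sum_j v j * fine (P (cell i j)))%:E <= \int[P]_x (X i x + eps)%:E)%E.
  apply: weighted_indic_le => //.
    by apply: measurable_funD => //; exact: measurable_funPT.
  by move=> x; rewrite sum_cell; exact: vle.
under eq_integral do rewrite EFinD.
rewrite ge0_integralD//=.
- have -> : (\int[P]__ eps%:E = eps%:E)%E.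
    by have := expectation_cst P eps; rewrite unlock.
  rewrite -expectation_def Emu -EFinD lee_fin.
  by under eq_bigr do rewrite mulrC.
- by move=> x _; rewrite lee_fin.
- by apply/measurable_EFinP; exact: measurable_funPT.
Qed.

(** Rounding up can only shrink the event, except where the rounded value already reaches lambda,
    and there the rounded sum is not below lambda. Independence gives the vector of cells its
    product weight. *)
Lemma discretized_le (lambda : R) : independent_RVs X -> (forall j, 0 <= v j) ->
  (forall x, 0 <= x -> x < v (idx x) \/ lambda <= v (idx x)) ->
  ((\sum_(f : {ffun 'I_n -> I}) (\prod_(i < n) fine (P (cell i (f i)))) *
     (\sum_(i < n) v (f i) < lambda)%R%:R)%:E <=
   P [set w | (\sum_(i < n) X i w < lambda)%R])%E.
Proof.
move=> indep v0 vlt.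
pose E (f : {ffun 'I_n -> I}) := \bigcap_(i in [set` [set: 'I_n]%SET]) cell i (f i).
have mE f : measurable (E f).
  apply: fin_bigcap_measurable => //; exact: finite_finset.
have PE f : fine (P (E f)) = \prod_(i < n) fine (P (cell i (f i))).
  rewrite /E (indep [set: 'I_n]%SET (fun i => B (f i)))//.
  rewrite (eq_bigl xpredT); last by move=> i; rewrite inE.
  rewrite (eq_bigr (fun i => (fine (P (cell i (f i))))%:E)) ?prodEFin//.
  by move=> i _; rewrite fineK// fin_num_measure.
have mS : measurable [set w | \sum_(i < n) X i w < lambda].
  have /(_ measurableT) := @measurable_fun_ltr _ _ _ setT (fun w => \sum_(i < n) X i w)
    (fun=> lambda) (measurable_sum _ (fun i => measurable_funPT (X i))) (measurable_cst _).
  by move=> /(_ [set true]) /=; rewrite setTI; exact.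
rewrite -[X in P X]setIT -integral_indic//.
under eq_bigr do rewrite -PE mulrC.
apply: weighted_indic_le => //.
(* The sample point x lies in [E f] for one f only, the vector of its cell indices. *)
move=> x; rewrite (bigD1 [ffun i => idx (X i x)])//= [X in _ + X]big1 ?addr0; last first.
  move=> f fn; rewrite [\1_(E f) x]indicE memNset ?mulr0// => Ef.
  move/eqP: fn; apply; apply/ffunP => i; rewrite ffunE.
  have iT : [set` [set: 'I_n]%SET] i by rewrite /= inE.
  by have /(BE _ (X0 i x)) := Ef i iT.
have [h|] := boolP (_ < lambda); last by rewrite mul0r indicE ler0n.
rewrite mul1r [leRHS]indicE mem_set ?[leLHS]indicE ?lern1 ?leq_b1//=.
apply/(le_lt_trans _ h)/ler_sum => i _; rewrite ffunE.
have [/ltW//|h2] := vlt _ (X0 i x).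
suff : v (idx (X i x)) < v (idx (X i x)) by rewrite ltxx.
apply: lt_le_trans h2; apply: le_lt_trans h.
by rewrite (bigD1 i)//= ffunE lerDl sumr_ge0.
Qed.

End Discretization.

Section Cells.
Variables (R : realType) (eps : R) (J : nat).
Hypothesis eps0 : 0 < eps.

(* The last cell is unbounded; its value only has to exceed the threshold that the
   sum is compared with. *)
Definition cell_set (j : 'I_J.+1) : set R :=
  if (j < J)%N then [set` `[j%:R * eps, j.+1%:R * eps[] else [set` `[J%:R * eps, +oo[].

Definition cell_index (x : R) : 'I_J.+1 := inord (minn (Num.truncn (x / eps)) J).

Definition cell_value (j : 'I_J.+1) : R := j.+1%:R * eps.

Lemma measurable_cell_set j : measurable (cell_set j).
Proof. by rewrite /cell_set; case: ifP => _; exact: measurable_itv. Qed.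

Lemma cell_indexE x : cell_index x = minn (Num.truncn (x / eps)) J :> nat.
Proof. by rewrite inordK// ltnS geq_minr. Qed.

Lemma cell_setP x j : 0 <= x -> cell_set j x <-> j = cell_index x.
Proof.
move=> x0; have xe : 0 <= x / eps by rewrite divr_ge0// ltW.
suff : cell_set j x <-> j = cell_index x :> nat.
  by move=> ->; split=> [/val_inj|->].
rewrite cell_indexE /cell_set.
case: ltnP => jJ.
  rewrite /= in_itv/= -ler_pdivlMr// -ltr_pdivrMr// -truncn_eq//.
  move: (Num.truncn _) => t; split; lia.
have -> : (j : nat) = J by apply/eqP; rewrite eqn_leq jJ andbT -ltnS.
rewrite /= in_itv/= andbT -ler_pdivlMr// -truncn_ge_nat//.
move: (Num.truncn _) => t; split; lia.
Qed.

Lemma cell_value_le x : 0 <= x -> cell_value (cell_index x) <= x + eps.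
Proof.
move=> x0; have xe : 0 <= x / eps by rewrite divr_ge0// ltW.
rewrite /cell_value cell_indexE -natr1 mulrDl mul1r lerD2r -ler_pdivlMr//.
by rewrite -truncn_ge_nat// geq_minl.
Qed.

Lemma cell_value_gt x lambda : 0 <= x -> lambda <= J.+1%:R * eps ->
  x < cell_value (cell_index x) \/ lambda <= cell_value (cell_index x).
Proof.
move=> x0 lJ; have xe : 0 <= x / eps by rewrite divr_ge0// ltW.
rewrite /cell_value cell_indexE; have [h|h] := leqP (Num.truncn (x / eps)) J.
  left; rewrite -ltr_pdivrMr//.
  by have /andP[] := truncn_itv xe.
by right.
Qed.

End Cells.

(** * The lower bound for arbitrary laws *)

Section LowerBound.
Variable R : realType.

Lemma exprn_lipschitz (x y : R) n : 0 <= y -> y <= x -> x <= 1 ->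
  x ^+ n - y ^+ n <= n%:R * (x - y).
Proof.
move=> y0 yx x1; elim: n => [|n IH]; first by rewrite !expr0 subrr mul0r.
have y1 : y <= 1 by apply: le_trans x1.
have -> : x ^+ n.+1 - y ^+ n.+1 = x * (x ^+ n - y ^+ n) + y ^+ n * (x - y).
  by rewrite !exprS; ring.
rewrite -natr1 mulrDl mul1r lerD//.
  apply: le_trans IH; rewrite ler_piMl// subr_ge0 lerXn2r// nnegrE//.
  exact: le_trans yx.
by rewrite ler_piMl ?subr_ge0// exprn_ile1.
Qed.

Definition sd_bound n (delta : R) : R :=
  Num.min (delta / (1 + delta)) ((1 - (n%:R + delta)^-1) ^+ n).

Lemma sd_boundE n delta : (0 < n)%N -> 0 < delta -> sd_bound n delta =
  Num.min (delta / (1 + delta)) (expR (- (n%:R * ell (n%:R + delta)))).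
Proof.
move=> n0 d0; rewrite /sd_bound -mulrN expRM_natl expR_ell//.
by have : 1 <= n%:R :> R; [rewrite ler1n|lra].
Qed.

(** Discretization yields the bound only at a < delta; this estimate lets a tend to delta. *)
Lemma sd_bound_lipschitz n (a b : R) : (0 < n)%N -> 0 < a -> a <= b ->
  sd_bound n b <= sd_bound n a + n%:R * (b - a).
Proof.
move=> n0 a0 ab; have n1 : 1 <= n%:R :> R by rewrite ler1n.
have ba : b - a <= n%:R * (b - a) by rewrite ler_peMl// subr_ge0.
have h1 : b / (1 + b) <= a / (1 + a) + n%:R * (b - a).
  apply: le_trans (lerD (lexx _) ba).
  rewrite -lerBlDl.
  have -> : b / (1 + b) - a / (1 + a) = (b - a) / ((1 + a) * (1 + b)).
    by field; rewrite !gt_eqF//; lra.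
  rewrite ler_pdivrMr ?mulr_gt0//; [|lra|lra].
  rewrite ler_peMr ?subr_ge0//.
  have : 0 <= a * b by rewrite mulr_ge0; lra.
  lra.
have na : 1 < n%:R + a by lra.
have nb : 1 < n%:R + b by lra.
have [ha0 ha1] := andP (inv_lt1 na); have [hb0 hb1] := andP (inv_lt1 nb).
have ab' : (n%:R + b)^-1 <= (n%:R + a)^-1 by rewrite lef_pV2 ?posrE; lra.
have h2 : (1 - (n%:R + b)^-1) ^+ n <= (1 - (n%:R + a)^-1) ^+ n + n%:R * (b - a).
  rewrite -lerBlDl; apply: le_trans (exprn_lipschitz _ _ _ _) _; [lra|lra|lra|].
  rewrite ler_wpM2l//.
  have -> : 1 - (n%:R + b)^-1 - (1 - (n%:R + a)^-1) = (b - a) / ((n%:R + a) * (n%:R + b)).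
    by field; rewrite !gt_eqF//; lra.
  rewrite ler_pdivrMr ?mulr_gt0//; [|lra|lra].
  rewrite ler_peMr ?subr_ge0//.
  rewrite -[1]mulr1 ler_pM//; lra.
by rewrite /sd_bound addr_minl le_min !ge_min h1 h2 orbT.
Qed.

Lemma expectation_RV_sum d (T : measurableType d) (P : probability T R) n
    (X : 'I_n -> {RV P >-> R}) (mu : 'I_n -> R) :
  (forall i w, 0 <= X i w) -> (forall i, 'E_P[X i] = (mu i)%:E)%E ->
  ('E_P[RV_sum X] = (\sum_i mu i)%:E)%E.
Proof.
move=> X0 Emu; rewrite unlock /RV_sum.
under eq_integral do rewrite -sumEFin.
rewrite ge0_integral_sum//=; last 2 first.
- by move=> i; apply/measurable_EFinP; exact: measurable_funPT.
- by move=> i x _; rewrite lee_fin.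
by rewrite -sumEFin; apply: eq_bigr => i _; rewrite -Emu expectation_def.
Qed.

Lemma small_deviation_prob_ge (d : measure_display) (T : measurableType d)
    (P : probability T R) n (X : 'I_n -> {RV P >-> R}) (delta : R) :
  (0 < n)%N -> 0 < delta -> admissible X ->
  ((sd_bound n delta)%:E <= small_deviation_prob X delta)%E.
Proof.
case: n X => // n X n0 d0 [indep X0 EX].
have n1 : 1 <= n.+1%:R :> R by rewrite ler1n.
pose mu i := fine ('E_P[X i])%E.
have Emu i : ('E_P[X i] = (mu i)%:E)%E.
  rewrite fineK// fin_numElt (lt_le_trans (ltNyr 0)) ?expectation_ge0//=.
  exact: le_lt_trans (EX i) (ltry _).
have mu1 i : mu i <= 1 by rewrite -lee_fin -Emu.
have mu0 i : 0 <= mu i by rewrite -lee_fin -Emu expectation_ge0.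
set M := \sum_(i < n.+1) mu i.
have ES : ('E_P[RV_sum X] = M%:E)%E by exact: expectation_RV_sum.
rewrite /small_deviation_prob ES.
have -> : [set w | ((RV_sum X w)%:E < M%:E + delta%:E)%E] =
    [set w | (\sum_(i < n.+1) X i w < M + delta)%R].
  by apply/seteqP; split=> w /=; rewrite -EFinD lte_fin.
have M0 : 0 <= M by rewrite sumr_ge0.
have Mn : M <= n.+1%:R.
  have : M <= \sum_(i < n.+1) (1 : R) by exact: ler_sum.
  by rewrite sumr_const card_ord.
suff key (a : R) : 0 < a -> a < delta ->
    ((sd_bound n.+1 a)%:E <= P [set w | (\sum_(i < n.+1) X i w < M + delta)%R])%E.
  apply/lee_addgt0Pr => e e0.
  (* The first term keeps the Lipschitz error below e, the second keeps a positive. *)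
  pose a := delta - Num.min (e / n.+1%:R) (delta / 2).
  have mn0 : 0 < Num.min (e / n.+1%:R) (delta / 2).
    by rewrite lt_min !divr_gt0//; lra.
  have mn1 : Num.min (e / n.+1%:R) (delta / 2) <= delta / 2 by rewrite ge_min lexx orbT.
  have mn2 : Num.min (e / n.+1%:R) (delta / 2) <= e / n.+1%:R by rewrite ge_min lexx.
  have a0 : 0 < a by rewrite /a; lra.
  have ad : a < delta by rewrite /a; lra.
  apply: (@le_trans _ _ ((sd_bound n.+1 a)%:E + e%:E)%E); last by rewrite leeD2r// key.
  rewrite -EFinD lee_fin; apply: le_trans (sd_bound_lipschitz n0 a0 (ltW ad)) _.
  rewrite lerD2l mulrC -ler_pdivlMr; last by lra.
  by rewrite /a subKr.
move=> a0 ad.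
(* This mesh solves n.+1 eps + a (1 + eps) = delta: the gap delta - a pays for rounding and
   rescaling. *)
pose eps := (delta - a) / (n.+1%:R + a).
have na0 : 0 < n.+1%:R + a by lra.
have eps0 : 0 < eps by rewrite divr_gt0// subr_gt0.
(* Enough cells for the value of the last one to reach the threshold M + delta. *)
pose J := Num.truncn ((M + delta) / eps).
have lJ : M + delta <= J.+1%:R * eps.
  rewrite -ler_pdivrMr// ltW//.
  have h : 0 <= (M + delta) / eps by rewrite divr_ge0 ?addr_ge0// ltW.
  by have /andP[] := truncn_itv h.
have v0 (j : 'I_J.+1) : 0 <= cell_value eps j by rewrite mulr_ge0// ltW.
have := @discretized_le _ _ _ P n.+1 X _ (@cell_set _ eps J) (@cell_index _ eps J)
  (@cell_value _ eps J) X0 (@measurable_cell_set _ _ _) (@cell_setP _ _ _ eps0) (M + delta)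
  indep v0 (fun x x0 => cell_value_gt eps0 x0 lJ).
apply: le_trans; rewrite lee_fin.
(* Rounded variables have mean at most 1 + eps; scaling by [kappa] brings it back to 1. *)
pose kappa := (1 + eps)^-1.
have k0 : 0 < kappa by rewrite invr_gt0; lra.
pose w (i : nat) j := fine (P (X (inord i) @^-1` @cell_set _ eps J j)).
pose v j := kappa * @cell_value _ eps J j.
have -> : \sum_(f : {ffun 'I_n.+1 -> 'I_J.+1})
    (\prod_(i < n.+1) fine (P (X i @^-1` cell_set eps (f i)))) *
      (\sum_(i < n.+1) cell_value eps (f i) < M + delta)%R%:R =
  fin_expect v w n.+1 (tp_prob [::]) (kappa * (M + delta)).
  rewrite -sum_ffun_fin_expect; apply: eq_bigr => f _.
  rewrite -mulr_sumr ltr_pM2l//; congr (_ * _).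
  by apply: eq_bigr => i _; rewrite /w inord_val.
have w0 i j : 0 <= w i j by rewrite fine_ge0.
have w1 i : \sum_j w i j = 1.
  exact: (@sum_prob_cell _ _ _ P n.+1 X _ (@cell_set _ eps J) (@cell_index _ eps J) X0
    (@measurable_cell_set _ _ _) (@cell_setP _ _ _ eps0)).
have wm i : fin_mean v w i <= kappa * (mu (inord i) + eps).
  have -> : fin_mean v w i = kappa * \sum_j w i j * cell_value eps j.
    by rewrite /fin_mean mulr_sumr; apply: eq_bigr => j _; rewrite mulrCA.
  rewrite ler_pM2l//.
  apply: (@mean_cell_le _ _ _ P n.+1 X _ (@cell_set _ eps J) (@cell_index _ eps J)) => //.
  - exact: measurable_cell_set.
  - by move=> x j; exact: cell_setP.
  - exact: ltW.
  - by move=> x; exact: cell_value_le.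
have km : kappa * (1 + eps) = 1 by rewrite mulVf// gt_eqF//; lra.
have wm1 i : fin_mean v w i <= 1.
  apply: le_trans (wm i) _; rewrite -km ler_pM2l// lerD2r//.
rewrite sd_boundE//.
have sumM : \sum_(i < n.+1) fin_mean v w i <= kappa * (M + n.+1%:R * eps).
  rewrite /M mulrDr mulr_sumr.
  apply: le_trans (ler_sum _ (fun (i : 'I_n.+1) _ => wm i)) _.
  under eq_bigr do rewrite inord_val mulrDr.
  rewrite big_split/= sumr_const card_ord -mulr_natl le_eqVlt.
  by apply/orP; left; apply/eqP; ring.
apply: (@le_trans _ _ (fin_expect v w n.+1 (tp_prob [::])
    (\sum_(i < n.+1) fin_mean v w i + tp_mean [::] + a))).
  apply: fin_expect_ge => //.
    by move=> j; rewrite mulr_ge0// ltW.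
  rewrite /tp_mean big_nil addr0.
  have : \sum_(i < n.+1) fin_mean v w i <= \sum_(i < n.+1) (1 : R) by exact: ler_sum.
  by rewrite sumr_const card_ord.
apply: fin_expect_le => //.
  by move=> x y xy; exact: tp_prob_le.
rewrite /tp_mean big_nil addr0; apply: le_trans (lerD sumM (lexx a)) _.
have -> : a = kappa * (a * (1 + eps)) by rewrite mulrCA km mulr1.
rewrite -mulrDr ler_pM2l// -addrA lerD2l.
have : eps * (n.+1%:R + a) = delta - a by rewrite /eps divfK// gt_eqF.
lra.
Qed.

End LowerBound.

(** * Extremal examples *)

Section FiniteProbability.
Variables (R : realType) (I : finType) (i0 : I) (c : I -> R).
Hypotheses (c0 : forall i, 0 <= c i) (c1 : \sum_i c i = 1).

(* The finite space I is coded into nat by its enumeration. *)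
Definition decode (k : nat) : I := nth i0 (enum I) k.

Definition decode_weight (k : nat) : {nonneg R} := NngNum (c0 (decode k)).

Definition finite_measure_nat : set nat -> \bar R :=
  msum (fun k => mscale (decode_weight k) (@dirac _ nat k R)) #|I|.

HB.instance Definition _ := Measure.on finite_measure_nat.

Lemma finite_measure_natE (A : set nat) :
  finite_measure_nat A = (\sum_i c i * \1_A (index i (enum I)))%:E.
Proof.
rewrite /finite_measure_nat /msum/= -sumEFin.
rewrite -[RHS]big_enum /= (big_nth i0) big_mkord -cardE.
apply: eq_bigr => k _; rewrite /mscale/= diracE indicE /decode.
by rewrite index_uniq ?enum_uniq// -cardE.
Qed.

Lemma finite_measure_nat_setT : finite_measure_nat setT = 1%E.
Proof.
rewrite finite_measure_natE; congr (_%:E).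
by under eq_bigr do rewrite indicT mulr1.
Qed.

HB.instance Definition _ :=
  @Measure_isProbability.Build _ _ R finite_measure_nat finite_measure_nat_setT.

Definition finite_prob_nat : probability nat R := finite_measure_nat.

Lemma finite_prob_natE (A : set I) :
  finite_prob_nat (decode @^-1` A) = (\sum_i c i * \1_A i)%:E.
Proof.
rewrite /finite_prob_nat/= finite_measure_natE; congr (_%:E).
apply: eq_bigr => i _; congr (_ * _).
have di : decode (index i (enum I)) = i by rewrite /decode nth_index ?mem_enum.
rewrite !indicE; congr (_%:R); congr nat_of_bool.
by apply/idP/idP => /set_mem Ai; apply/mem_set; rewrite /preimage/= di in Ai *.
Qed.

End FiniteProbability.

Section BernoulliProduct.
Variables (R : realType) (n : nat) (p : R) (x : 'I_n -> bool -> R).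
Hypotheses (p01 : 0 <= p <= 1) (x0 : forall i b, 0 <= x i b).

Definition bernoulli_weight (b : bool) : R := if b then p else 1 - p.

Definition product_weight (f : {ffun 'I_n -> bool}) : R :=
  \prod_i bernoulli_weight (f i).

Lemma bernoulli_weight_ge0 b : 0 <= bernoulli_weight b.
Proof. by case/andP: p01; case: b => /=; rewrite ?subr_ge0. Qed.

Lemma sum_bernoulli_weight : \sum_b bernoulli_weight b = 1.
Proof. by rewrite big_bool/= addrC subrK. Qed.

Lemma product_weight_ge0 f : 0 <= product_weight f.
Proof. by apply: prodr_ge0 => i _; exact: bernoulli_weight_ge0. Qed.

(** Distributivity, with coordinates outside J summing to 1. Total mass, independence and marginals
    are all instances. *)
Lemma sum_product_weight_prod (J : {set 'I_n}) (G : 'I_n -> bool -> R) :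
  \sum_f product_weight f * \prod_(i in J) G i (f i) =
  \prod_(i in J) \sum_b bernoulli_weight b * G i b.
Proof.
transitivity (\prod_i \sum_b bernoulli_weight b * (if i \in J then G i b else 1)).
  rewrite bigA_distr_bigA/=; apply: eq_bigr => f _.
  by rewrite [in LHS]big_mkcond/= -big_split.
rewrite [RHS]big_mkcond/=; apply: eq_bigr => i _; case: ifP => // _.
by under eq_bigr do rewrite mulr1; exact: sum_bernoulli_weight.
Qed.

Lemma sum_product_weight : \sum_f product_weight f = 1.
Proof.
have := sum_product_weight_prod finset.set0 (fun _ _ => 1).
rewrite !big_set0; under eq_bigr do rewrite mulr1.
by [].
Qed.

Definition bernoulli_product : probability nat R :=
  finite_prob_nat [ffun=> false] product_weight_ge0 sum_product_weight.

Definition bernoulli_coord (i : 'I_n) (k : nat) : R :=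
  x i (decode [ffun=> false] k i).

Lemma measurable_bernoulli_coord i : measurable_fun setT (bernoulli_coord i).
Proof. by []. Qed.

HB.instance Definition _ i := @isMeasurableFun.Build _ _ nat R
  (bernoulli_coord i) (measurable_bernoulli_coord i).

Definition bernoulli_RV (i : 'I_n) : {RV bernoulli_product >-> R} := bernoulli_coord i.

Lemma bernoulli_productE (A : set {ffun 'I_n -> bool}) :
  bernoulli_product (decode [ffun=> false] @^-1` A) =
  (\sum_f product_weight f * \1_A f)%:E.
Proof. exact: finite_prob_natE. Qed.

Lemma bernoulli_product_bigcap (J : {set 'I_n}) (B : 'I_n -> set R) :
  bernoulli_product (\bigcap_(i in [set` J]) (bernoulli_RV i @^-1` B i)) =
  (\prod_(i in J) \sum_b bernoulli_weight b * \1_(B i) (x i b))%:E.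
Proof.
rewrite -(sum_product_weight_prod J (fun i b => \1_(B i) (x i b))).
rewrite -[X in bernoulli_product X]/(decode [ffun=> false] @^-1`
  [set f : {ffun 'I_n -> bool} | forall i, [set` J] i -> B i (x i (f i))]).
rewrite bernoulli_productE; congr (_%:E); apply: eq_bigr => f _; congr (_ * _).
rewrite indicE; case: (pselect (forall i, [set` J] i -> B i (x i (f i)))) => h.
  by rewrite mem_set// big1// => i iJ; rewrite indicE mem_set//; exact: h.
rewrite memNset//; move/existsNP : h => [i /not_implyP[iJ nB]].
by rewrite (bigD1 i)//= indicE memNset// mul0r.
Qed.

Lemma bernoulli_product_preimage i (B : set R) :
  bernoulli_product (bernoulli_RV i @^-1` B) =
  (\sum_b bernoulli_weight b * \1_B (x i b))%:E.
Proof.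
have := bernoulli_product_bigcap [set i]%SET (fun=> B).
rewrite big_set1 (_ : [set` [set i]%SET] = [set i]) ?bigcap_set1//.
by apply/seteqP; split=> j /=; rewrite inE => /eqP.
Qed.

Lemma independent_bernoulli_RV : independent_RVs bernoulli_RV.
Proof.
move=> J B mB; rewrite bernoulli_product_bigcap -prodEFin.
by apply: eq_bigr => i _; rewrite bernoulli_product_preimage.
Qed.

Lemma expectation_bernoulli_RV i :
  ('E_bernoulli_product[bernoulli_RV i] = ((1 - p) * x i false + p * x i true)%:E)%E.
Proof.
pose A b := decode [ffun=> false] @^-1` [set f : {ffun 'I_n -> bool} | f i = b].
have PA b : fine (bernoulli_product (A b)) = bernoulli_weight b.
  rewrite bernoulli_productE/=.
  transitivity (\sum_f product_weight f * \prod_(j in [set i]%SET) (f j == b)%:R);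
    last first.
    rewrite (sum_product_weight_prod _ (fun _ b' => (b' == b)%:R)) big_set1 big_bool.
    by case: (b); rewrite /= mulr1 mulr0 ?addr0 ?add0r.
  apply: eq_bigr => f _; rewrite big_set1 indicE; congr (_ * _%:R); congr nat_of_bool.
  by apply/idP/eqP => [/set_mem|fb]; last exact/mem_set.
rewrite unlock.
transitivity (\int[bernoulli_product]_k (\sum_b x i b * \1_(A b) k)%:E)%E.
  apply: eq_integral => k _; congr (_%:E).
  rewrite (bigD1 (decode [ffun=> false] k i))//= indicE mem_set// mulr1 big1 ?addr0// => b bn.
  rewrite indicE memNset ?mulr0// => Ab; move/eqP: bn; apply.
  by rewrite -Ab.
rewrite integral_weighted_indic//; congr (_%:E).
by rewrite big_bool/= !PA/= addrC ![x i _ * _]mulrC.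
Qed.

Lemma bernoulli_product_sum_lt lambda :
  bernoulli_product [set k | \sum_i bernoulli_RV i k < lambda] =
  (\sum_f product_weight f * (\sum_i x i (f i) < lambda)%R%:R)%:E.
Proof.
rewrite -[X in bernoulli_product X]/(decode [ffun=> false] @^-1`
  [set f : {ffun 'I_n -> bool} | \sum_i x i (f i) < lambda]).
rewrite bernoulli_productE; congr (_%:E); apply: eq_bigr => f _; congr (_ * _%:R).
congr nat_of_bool.
by apply/idP/idP => [/set_mem|h]; last exact/mem_set.
Qed.

End BernoulliProduct.

Section Attained.
Variable R : realType.

Lemma bernoulli_product_attains n (p delta : R) (x : 'I_n -> bool -> R) :
  0 <= p <= 1 -> (forall i b, 0 <= x i b) ->
  (forall i, (1 - p) * x i false + p * x i true = 1) ->
  exists (d : measure_display) (T : measurableType d) (P : probability T R)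
    (X : 'I_n -> {RV P >-> R}), admissible X /\
    small_deviation_prob X delta = (\sum_f product_weight p f *
      (\sum_i x i (f i) < n%:R + delta)%R%:R)%:E.
Proof.
move=> p01 x0 x1.
have EX i : ('E_(bernoulli_product n p01)[bernoulli_RV x p01 i] = 1%:E)%E.
  by rewrite expectation_bernoulli_RV// x1.
have X0 i w : 0 <= bernoulli_RV x p01 i w by exact: x0.
exists _, nat, (bernoulli_product n p01), (bernoulli_RV x p01); split.
  split=> //; first exact: independent_bernoulli_RV.
  by move=> i; rewrite EX.
rewrite /small_deviation_prob (expectation_RV_sum X0 EX) sumr_const card_ord.
rewrite -(bernoulli_product_sum_lt x p01); congr (bernoulli_product n p01 _).
Qed.

Lemma iid_attains n (delta : R) : (0 < n)%N -> 0 < delta ->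
  exists (d : measure_display) (T : measurableType d) (P : probability T R)
    (X : 'I_n -> {RV P >-> R}), admissible X /\
    small_deviation_prob X delta = ((1 - (n%:R + delta)^-1) ^+ n)%:E.
Proof.
move=> n0 d0; have n1 : 1 <= n%:R :> R by rewrite ler1n.
have nd0 : 0 < n%:R + delta by lra.
have nd1 : 1 < n%:R + delta by lra.
have p01 : 0 <= (n%:R + delta)^-1 <= 1.
  by have /andP[h1 h2] := inv_lt1 nd1; rewrite !ltW.
have := @bernoulli_product_attains n _ delta
  (fun _ b => if b then n%:R + delta else 0) p01.
case=> [i []//|i|]; first exact: ltW.
  by rewrite mulr0 add0r mulVf// gt_eqF.
move=> d [T [P [X [aX E]]]]; exists d, T, P, X; split=> //; rewrite E; congr (_%:E).
(* A single nonzero variable already reaches n + delta, so only the all-false outcome counts. *)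
rewrite (bigD1 [ffun=> false])//= big1 => [|i _]; last by rewrite ffunE.
rewrite nd0 mulr1 [X in _ + X]big1 ?addr0 => [|f fn].
  rewrite /product_weight (eq_bigr (fun=> 1 - (n%:R + delta)^-1)).
    by rewrite prodr_const card_ord.
  by move=> i _; rewrite ffunE.
have [i fi] : exists i, f i.
  apply/existsP; apply: contraNT fn => /existsPn h.
  by apply/eqP/ffunP => i; rewrite ffunE; apply/negbTE; exact: h.
rewrite (bigD1 i)//= fi ltNge lerDl sumr_ge0 ?mulr0// => j _.
by case: (f j) => //; exact: ltW.
Qed.

Lemma dictator_attains n (delta : R) : (0 < n)%N -> 0 < delta ->
  exists (d : measure_display) (T : measurableType d) (P : probability T R)
    (X : 'I_n -> {RV P >-> R}), admissible X /\
    small_deviation_prob X delta = (delta / (1 + delta))%:E.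
Proof.
case: n => // n _ d0; have d1 : 1 < 1 + delta by lra.
have d10 : 0 < 1 + delta by lra.
have p01 : 0 <= (1 + delta)^-1 <= 1.
  by have /andP[h1 h2] := inv_lt1 d1; rewrite !ltW.
have := @bernoulli_product_attains n.+1 _ delta
  (fun i b => if i == ord0 then if b then 1 + delta else 0 else 1) p01.
case=> [i b|i|].
- by case: eqP => // _; case: b => //; exact: ltW.
- case: eqP => _; last by rewrite !mulr1 subrK.
  by rewrite mulr0 add0r mulVf// gt_eqF.
move=> d [T [P [X [aX E]]]]; exists d, T, P, X; split=> //; rewrite E; congr (_%:E).
(* The event is that the first variable is 0: the sum is then n, and otherwise n.+1 + delta, the
   threshold itself, which the strict inequality excludes. *)
have := sum_product_weight_prod (1 + delta)^-1 [set ord0]%SET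
  (fun (_ : 'I_n.+1) b => (~~ b)%:R).
rewrite big_set1 big_bool/= mulr0 add0r mulr1.
have -> : 1 - (1 + delta)^-1 = delta / (1 + delta) by field; rewrite gt_eqF.
move=> <-; apply: eq_bigr => f _; rewrite big_set1; congr (_ * _%:R).
congr nat_of_bool; rewrite big_ord_recl eqxx.
rewrite (eq_bigr (fun=> 1)) => [|i _]; last by [].
rewrite sumr_const card_ord -natr1.
by case: (f ord0) => /=; apply/idP/idP; lra.
Qed.

End Attained.

(** * The infimum over the number of variables *)

Section Infimum.
Variable R : realType.

Lemma sd_bound_ge_min n (delta : R) : (0 < n)%N -> 0 < delta ->
  Num.min (delta / (1 + delta)) (expR (-1)) <= sd_bound n delta.
Proof.
move=> n0 d0; rewrite sd_boundE// le_min ge_min lexx/=.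
have n1 : 1 <= n%:R :> R by rewrite ler1n.
have d1 : 1 < 1 + delta by lra.
have -> : delta / (1 + delta) = expR (- ell (1 + delta)).
  by rewrite expR_ell//; field; rewrite gt_eqF//; lra.
have := mul_ell_le_max n1 d0.
by rewrite le_max ge_min !ler_expR !lerN2.
Qed.

(** (1 - s) ^ n <= expR (- n s) at s = 1 / (n + delta), where n s = 1 - t with t = delta / (n +
    delta), and expR t <= 1 / (1 - t) = 1 + delta / n. *)
Lemma sd_bound_le_expRN1 n (delta : R) : (0 < n)%N -> 0 < delta ->
  sd_bound n delta <= expR (-1) + delta / n%:R.
Proof.
move=> n0 d0; have n1 : 1 <= n%:R :> R by rewrite ler1n.
have np : 0 < n%:R :> R by lra.
have nd0 : 0 < n%:R + delta by lra.
have [hi0 hi1] : 0 < (n%:R + delta)^-1 /\ (n%:R + delta)^-1 < 1.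
  by apply/andP/inv_lt1; lra.
rewrite /sd_bound ge_min; apply/orP; right.
have h1 : (1 - (n%:R + delta)^-1) ^+ n <= expR (n%:R * - (n%:R + delta)^-1).
  rewrite expRM_natl lerXn2r ?nnegrE ?expR_ge0 ?expR_ge1Dx//; lra.
apply: (le_trans h1).
have -> : n%:R * - (n%:R + delta)^-1 = -1 + delta / (n%:R + delta).
  by field; rewrite gt_eqF.
rewrite expRD.
set t := delta / (n%:R + delta).
have t1 : 1 - t = n%:R / (n%:R + delta) by rewrite /t; field; rewrite gt_eqF.
have t0 : 0 < 1 - t by rewrite t1 divr_gt0.
have ht : expR t <= 1 + delta / n%:R.
  have -> : 1 + delta / n%:R = (1 - t)^-1.
    by rewrite t1 invf_div; field; rewrite gt_eqF.
  rewrite -[t in leLHS]opprK expRN lef_pV2 ?posrE ?expR_gt0//.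
  exact: expR_ge1Dx.
have e1 : expR (-1) <= 1 :> R by rewrite expR_le1; lra.
have e0 := expR_ge0 (-1 : R).
apply: le_trans (ler_wpM2l e0 ht) _.
rewrite mulrDr mulr1 lerD2l ler_piMl// divr_ge0//; exact: ltW.
Qed.

End Infimum.

Theorem corollary1p3 (R : realType) :
  (forall (n : nat) (delta : R), (1 <= n)%N -> 0 < delta ->
     let bound : R := Num.min (delta / (1 + delta))
                              ((1 - (n%:R + delta)^-1) ^+ n) in
     c_inf n delta = bound%:E /\
     (exists (d : measure_display) (T : measurableType d)
        (P : probability T R) (X : 'I_n -> {RV P >-> R}),
        admissible X /\ small_deviation_prob X delta = bound%:E)) /\
  (forall delta : R, 0 < delta ->
     ereal_inf [set c_inf n delta | n in [set n : nat | (1 <= n)%N]] =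
     (Num.min (delta / (1 + delta)) (expR (-1)))%:E).
Proof.
have attained (n : nat) (delta : R) : (0 < n)%N -> 0 < delta ->
    exists (d : measure_display) (T : measurableType d)
      (P : probability T R) (X : 'I_n -> {RV P >-> R}),
      admissible X /\ small_deviation_prob X delta = (sd_bound n delta)%:E.
  move=> n0 d0; rewrite /sd_bound /Num.min; case: ifP => _.
    exact: dictator_attains.
  exact: iid_attains.
have cE (n : nat) (delta : R) : (0 < n)%N -> 0 < delta ->
    c_inf n delta = (sd_bound n delta)%:E.
  move=> n0 d0; apply/eqP; rewrite eq_le; apply/andP; split.
    have [d [T [P [X [aX E]]]]] := attained n delta n0 d0.
    by apply: ereal_inf_lbound; exists d, T, P, X.
  apply: le_ereal_inf_tmp => _ [d [T [P [X [aX ->]]]]].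
  exact: small_deviation_prob_ge.
split=> [n delta n0 d0 bound|delta d0].
  by split; [exact: cE | exact: attained].
apply/eqP; rewrite eq_le; apply/andP; split; last first.
  apply: le_ereal_inf_tmp => _ [n /= n0 <-].
  by rewrite cE// lee_fin sd_bound_ge_min.
have inf_le n : (0 < n)%N ->
    (ereal_inf [set c_inf n delta | n in [set n : nat | (1 <= n)%N]] <=
     (sd_bound n delta)%:E)%E.
  by move=> n0; rewrite -cE//; apply: ereal_inf_lbound; exists n.
(* When the first term is the minimum, n = 1 already suffices; otherwise n is taken so large that
   delta / n <= e. *)
have [_|_] := leP (delta / (1 + delta)) (expR (-1)).
  by apply: le_trans (inf_le 1%N isT) _; rewrite lee_fin /sd_bound ge_min lexx.
apply/lee_addgt0Pr => e e0.
pose n := (Num.truncn (delta / e)).+1.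
have h : delta / n%:R <= e.
  rewrite ler_pdivrMr// mulrC -ler_pdivrMr// ltW//.
  by have /andP[] := truncn_itv (divr_ge0 (ltW d0) (ltW e0)).
apply: le_trans (inf_le n isT) _; rewrite -EFinD lee_fin.
by apply: le_trans (sd_bound_le_expRN1 _ d0) _; rewrite ?lerD2l.
Qed.
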